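(* Any circular arc which is not the full circle can be moved continuously to any other position in the plane (of the same size) in arbitrarily small area via similarity transformations, such that the size of the arc always remains arbitrarily close to its initial size. That is: let $E\subset\mathbb{R}^2$ be a circular arc which is not a full circle. Then for every $g\in\mathrm{Isom}^+(\mathbb{R}^2)$ and all $\varepsilon,\eta>0$ there is a continuous map $\gamma:[0,1]\to\mathrm{Sim}^+(\mathbb{R}^2)$ with $\gamma(0)=\mathrm{id}$ and $\gamma(1)=g$ such that $$\Big|\bigcup_{t\in[0,1]}\gamma(t)(E)\Big|<\varepsilon$$ and for every $t\in[0,1]$ the similarity ratio of $\gamma(t)$ lies in $(1-\eta,1+\eta)$.
   Context: $\mathrm{Isom}^+(\mathbb{R}^2)$ and $\mathrm{Sim}^+(\mathbb{R}^2)$ are the spaces of orientation-preserving isometries, respectively orientation-preserving similarity transformations, of $\mathbb{R}^2$, with their usual topologies. $|\cdot|$ is Lebesgue measure on $\mathbb{R}^2$. A circular arc is a closed connected subset of a circle (so an arc that is not the full circle has angle strictly less than $2\pi$). *)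

(* Defs.v *)
From HB Require Import structures.
From mathcomp Require Import all_boot all_order all_algebra.
From mathcomp Require Import all_classical all_reals all_analysis.

Set Implicit Arguments.
Unset Strict Implicit.
Unset Printing Implicit Defensive.

Import Order.TTheory GRing.Theory Num.Theory.
Import numFieldNormedType.Exports.

Local Open Scope classical_set_scope.
Local Open Scope ring_scope.

(* The norm that the library puts on [R * R] is the sup norm (it induces the
   usual topology), so the Euclidean distance is defined explicitly. *)
Definition edist (R : realType) (x y : R * R) : R :=
  Num.sqrt ((x.1 - y.1) ^+ 2 + (x.2 - y.2) ^+ 2).

Definition similarity (R : realType) (rho : R) (f : R * R -> R * R) : Prop :=
  0 < rho /\ forall x y, edist (f x) (f y) = rho * edist x y.

(* A similarity is affine, and the columns of its linear part are
   [f (1, 0) - f (0, 0)] and [f (0, 1) - f (0, 0)]; the expression below is the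
   determinant of that linear part. It is used for similarities only. *)
Definition orientation_preserving (R : realType) (f : R * R -> R * R) : Prop :=
  let u := f (1, 0) - f (0, 0) in
  let v := f (0, 1) - f (0, 0) in
  0 < u.1 * v.2 - u.2 * v.1.

Definition Sim_plus (R : realType) : set (R * R -> R * R) :=
  [set f | (exists rho : R, similarity rho f) /\ orientation_preserving f].

Definition Isom_plus (R : realType) : set (R * R -> R * R) :=
  [set f | (forall x y, edist (f x) (f y) = edist x y) /\
           orientation_preserving f].

Definition circle (R : realType) (c : R * R) (r : R) : set (R * R) :=
  [set x | edist c x = r].

Definition circular_arc (R : realType) (c : R * R) (r : R) (E : set (R * R)) :
  Prop := [/\ E `<=` circle c r, closed E & connected E].

Definition area (R : realType) : set (R * R) -> \bar R :=
  (@lebesgue_measure R \x @lebesgue_measure R)%E.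

(* The usual topology of the transformation groups of the plane is the one
   induced by the compact-open topology; on affine maps it is the topology
   of the coefficients. *)
Definition continuous_motion (R : realType) (gamma : R -> R * R -> R * R) :
  Prop :=
  {within `[0, 1]%classic,
    continuous (gamma : R -> {compact-open, (R * R)%type -> (R * R)%type})}.

Definition swept (R : realType) (gamma : R -> R * R -> R * R)
    (E : set (R * R)) : set (R * R) :=
  \bigcup_(t in `[0, 1]%classic) (gamma t @` E).

(* Main.v *)
Require Import Defs.
From mathcomp Require Import all_boot all_order all_algebra.
From mathcomp Require Import all_classical all_reals all_analysis.
From mathcomp Require Import measurable_realfun ring lra.
Import Order.TTheory GRing.Theory Num.Theory.
Import numFieldNormedType.Exports.
Local Open Scope classical_set_scope.
Local Open Scope ring_scope.

(** A circle is a point [p] of R^3: its centre together with its radius. When [p]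
moves with velocity [u], the point of the circle at angle [t] moves along the
normal with speed [speed t u], a linear functional of [u]. Turning a circle about
its centre sweeps no area. So the motion of the arc is governed by a path in R^3
together with the position, at each time, of the gap of the arc, and this position
can be changed for free. A block of angles that is placed inside the gap is hidden:
it sweeps nothing.

Two blocks at a positive distance ([two_arcs]). Suppose that only the angles of two
blocks count and that at each time one of the two is hidden. Then close to each
segment of R^3 there is a path with the same endpoints that sweeps as little as
desired. To see this, let the counted part of each block grow from the empty set in
steps of length [d]. While one part is empty, it suffices to hide the other one all
the time. When an interval [J] of length [d], with far end [t], is added to the
counted part of the second block, look first at a velocity [u] with
[speed t u = 0]. The segment directed by [u] sweeps only O(d^2 |u|) over [J], and
every path that is close enough to it sweeps hardly more over [J]. Moreover [u]
differs by O(d |u|) from a velocity that is still at the near end of [J], so a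
fine zigzag near the segment, whose pieces are in turn replaced by the paths known
from the previous step, costs hardly more over the previously counted angles. The
remaining velocities are reached because the kernels of [speed s] and [speed t], for
[s] and [t] in different blocks, are distinct planes and span R^3
([still_decomp]). The cost per unit length [a] of the velocities in these kernels
thus obeys a(m + 1) <= (1 + O(d)) a(m) + O(d^2) and starts at 0, so that after
O(1/d) steps it is O(d) ([crossable_grid]).

All blocks ([gap_crossing]). Cut the circle into blocks that fit into the gap,
separated by short intervals. The short intervals sweep little, because the path
stays close to the given segment. The blocks are treated one by one: if a path is
good for the blocks treated so far, replace each of its pieces, along which a block
[h] is hidden, by a path for the pair formed by [h] and the new block [k]. This path
is good for [h] and for [k], and the other blocks see a path that is so close to
the old piece that it sweeps hardly more.

Motion. The initial and the final circle have the same radius, so the radius stays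
nearly constant along a path close to the segment that joins them. The arc is
carried along this path, and it turns about its centre between consecutive pieces
([route_joined]). *)

Set Implicit Arguments.
Unset Strict Implicit.
Unset Printing Implicit Defensive.

(** * Elementary trigonometry *)

Lemma sin_lip (R : realType) (x y : R) : `|sin x - sin y| <= `|x - y|.
Proof.
wlog xy : x y / y <= x.
  move=> H; have [/H//|/ltW/H] := leP y x.
  by rewrite distrC [leRHS]distrC.
have [c _ ->] := @MVT_segment R sin cos y x xy
  (fun x _ => is_derive_sin x) (continuous_subspaceT (@continuous_sin R)).
by rewrite normrM ler_piMl// cos_max.
Qed.

Lemma cos_lip (R : realType) (x y : R) : `|cos x - cos y| <= `|x - y|.
Proof.
have -> : cos x - cos y = sin (y - pi / 2) - sin (x - pi / 2).
  by rewrite !sinBpihalf; ring.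
apply: le_trans (sin_lip _ _) _.
by rewrite distrC (_ : _ - _ = x - y)//; ring.
Qed.

Lemma sin_le_norm (R : realType) (x : R) : `|sin x| <= `|x|.
Proof. by have := sin_lip x 0; rewrite sin0 !subr0. Qed.

Lemma one_minus_cos_le (R : realType) (x : R) : 1 - cos x <= x ^+ 2.
Proof.
have -> : cos x = 1 - sin (x / 2) ^+ 2 *+ 2.
  have {1}-> : x = (x / 2) *+ 2 by rewrite -mulr_natr; field.
  by rewrite cos_mulr2n cos2sin2; ring.
have : sin (x / 2) ^+ 2 <= (x / 2) ^+ 2.
  by rewrite -(ger0_norm (sqr_ge0 (sin _))) -(ger0_norm (sqr_ge0 (x / 2)))
     !normrX lerXn2r ?nnegrE// sin_le_norm.
have := sqr_ge0 x.
rewrite exprMn (_ : 2^-1 ^+ 2 = 4^-1 :> R); last by field.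
by rewrite -mulr_natr; lra.
Qed.

(** Two angles whose difference lies in [tau, 2 * pi - tau] are at distance at least
[tau] on the circle; this turns a distance between blocks into a bound on cosines. *)
Lemma cosBlt_away (R : realType) (tau x : R) :
  0 < tau -> tau <= pi -> tau <= x <= 2 * pi - tau -> cos x <= cos tau.
Proof.
move=> t0 tpi.
wlog xpi : x / x <= pi.
  move=> H /andP[h1 h2]; have [xpi|/ltW xpi] := leP x pi; first by apply: H => //; apply/andP.
  have -> : cos x = cos (2 * pi - x).
    by rewrite -[LHS]cosN -[LHS]cosD2pi; congr cos; rewrite -mulr_natl; ring.
  by apply: H; [lra|apply/andP; split; lra].
move=> /andP[tx _].
rewrite leNgt ltr_cos ?in_itv/= -?leNgt//; apply/andP; split; lra.
Qed.

(** * Areas from one-dimensional sections *)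

Lemma integral_le_box (R : realType) (f : R -> \bar R) (a w k : R) :
  measurable_fun setT f -> 0 <= w -> 0 <= k ->
  (forall x, (0 <= f x)%E) -> (forall x, (f x <= k%:E)%E) ->
  (forall x, w < `|x - a| -> f x = 0%E) ->
  (\int[@lebesgue_measure R]_x f x <= (k * (w *+ 2))%:E)%E.
Proof.
move=> mf w0 k0 f0 fk fw.
have -> : ((k * (w *+ 2))%:E =
    \int[@lebesgue_measure R]_(x in `[(a - w)%R, (a + w)%R]) (cst k%:E x))%E.
  rewrite integral_cst//= lebesgue_measure_itv/= lte_fin.
  case: ltP => h; rewrite -EFinM; congr EFin.
    by rewrite -mulr_natl; ring.
  have -> : w = 0 by apply/eqP; rewrite eq_le; apply/andP; split; lra.
  by rewrite mul0rn.
rewrite [leRHS]integral_mkcond; apply: ge0_le_integral => //=.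
- by apply: (measurable_restrictT _ _).1 => //; exact: measurable_cst.
- move=> x _; rewrite patchE; case: ifPn => [_|]; first exact: fk.
  rewrite notin_setE/= in_itv/= => xn; rewrite fw// ltNge; apply/negP => xa.
  by apply: xn; move: xa; rewrite ler_norml => /andP[? ?]; apply/andP; split; lra.
Qed.

Lemma area_le_xsection (R : realType) (U : set (R * R)) (a w k : R) :
  measurable U -> 0 <= w -> 0 <= k ->
  (forall z, U z -> `|z.1 - a| <= w) ->
  (forall x, ((@lebesgue_measure R) (xsection U x) <= k%:E)%E) ->
  (area U <= (k * (w *+ 2))%:E)%E.
Proof.
move=> mU w0 k0 Uw Uk; apply: (integral_le_box (a := a)) => //.
- exact: measurable_fun_xsection.
- move=> x xw /=; have -> : xsection U x = set0; last by rewrite measure0.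
  apply/seteqP; split => // y; rewrite /xsection/= inE => /Uw /=.
  by rewrite /= leNgt xw.
Qed.

Lemma area_le_ysection (R : realType) (U : set (R * R)) (a w k : R) :
  measurable U -> 0 <= w -> 0 <= k ->
  (forall z, U z -> `|z.2 - a| <= w) ->
  (forall y, ((@lebesgue_measure R) (ysection U y) <= k%:E)%E) ->
  (area U <= (k * (w *+ 2))%:E)%E.
Proof.
move=> mU w0 k0 Uw Uk.
rewrite /area (@product_measure_unique _ _ _ _ _ _ _
  (product_measure2 (@lebesgue_measure R) (@lebesgue_measure R)))//; last first.
  by move=> A B mA mB; exact: product_measure2E.
apply: (integral_le_box (a := a)) => //.
- exact: measurable_fun_ysection.
- move=> x xw /=; have -> : ysection U x = set0; last by rewrite measure0.
  apply/seteqP; split => // y; rewrite /ysection/= inE => /Uw /=.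
  by rewrite /= leNgt xw.
Qed.

(** The product measure of an arbitrary set is the integral of the outer measures of
its sections, and the integral of a nonnegative function is a supremum over simple
functions below it; both operations are monotone. *)
Lemma area_le (R : realType) (A U : set (R * R)) :
  measurable U -> A `<=` U -> (area A <= area U)%E.
Proof.
move=> mU AU; rewrite /area /product_measure1.
rewrite ge0_integralTE; last by move=> x; exact: measure_ge0.
rewrite ge0_integralTE//.
apply: le_ereal_sup => _ [h hf <-]; exists h => // x.
apply: le_trans (hf x) _.
rewrite /lebesgue_measure.
by apply: le_outer_measure => y; rewrite /xsection/= !inE; exact: AU.
Qed.

(** * Covers that are stable under small enlargements *)

Definition nbhd (R : realType) (W : normedModType R) (A : set W) (e : R) : set W :=
  [set x | exists2 y, A y & `|x - y| <= e].

Lemma nbhdS (R : realType) (W : normedModType R) (A B : set W) (e : R) :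
  A `<=` B -> nbhd A e `<=` nbhd B e.
Proof. by move=> AB x [y /AB By xy]; exists y. Qed.

Lemma nbhdW (R : realType) (W : normedModType R) (A : set W) (d e : R) :
  d <= e -> nbhd A d `<=` nbhd A e.
Proof. by move=> de x [y Ay xy]; exists y => //; exact: le_trans de. Qed.

Lemma sub_nbhd (R : realType) (W : normedModType R) (A : set W) (e : R) :
  0 <= e -> A `<=` nbhd A e.
Proof. by move=> e0 x Ax; exists x => //; rewrite subrr normr0. Qed.

Lemma nbhdD (R : realType) (W : normedModType R) (A : set W) (d e : R) :
  nbhd (nbhd A d) e `<=` nbhd A (d + e).
Proof.
move=> x [y [z Az yz] xy]; exists z => //.
by rewrite -(subrKA y) addrC (le_trans (ler_normD _ _))// lerD.
Qed.

Lemma norm_pair (R : realType) (U W : normedModType R) (z : U * W) :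
  [/\ `|z.1| <= `|z|, `|z.2| <= `|z| & forall b, `|z.1| <= b -> `|z.2| <= b -> `|z| <= b].
Proof.
split; rewrite prod_normE ?le_max ?lexx ?orbT// => b h1 h2.
by rewrite ge_max h1 h2.
Qed.

Section rectangles.
Context {R : realType}.
Implicit Types (A U : set (R * R)) (z : R * R) (t l h a e : R).

(** The rectangle with centre [z] whose side of half-length [h] points in the
direction [t]. *)
Definition rect z t l h : set (R * R) :=
  [set x | `|cos t * (x.1 - z.1) + sin t * (x.2 - z.2)| <= h /\
           `|cos t * (x.2 - z.2) - sin t * (x.1 - z.1)| <= l].

Lemma measurable_rect z t l h : measurable (rect z t l h).
Proof.
have mf (f : R * R -> R) b : measurable_fun setT f -> measurable [set x | `|f x| <= b].
  move=> mf; rewrite (_ : [set _ | _] = setT `&` f @^-1` `[- b, b]); last first.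
    by apply/seteqP; split=> x /=; rewrite in_itv/= ler_norml => // -[].
  exact: mf.
apply: measurableI; apply: (mf (fun x => _ : R)).
- apply: measurable_funD; apply: measurable_funM => //; apply: measurable_funB => //.
- apply: measurable_funB; apply: measurable_funM => //; apply: measurable_funB => //.
Qed.

(** One of [cos t] and [sin t] is at least 1/2 in absolute value; slicing in the
corresponding coordinate direction gives sections of length at most [4 * h]. The
value is not sharp, but it is small with [h]. *)
Lemma area_rect z t l h : 0 <= l -> 0 <= h ->
  (area (rect z t l h) <= (8 * h * (l + h))%:E)%E.
Proof.
move=> l0 h0.
have c2 := cos2Dsin2 t; have c1 := cos_max t; have s1 := sin_max t.
have bound (x y c s : R) : c ^+ 2 + s ^+ 2 = 1 -> `|c| <= 1 -> `|s| <= 1 ->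
    `|c * x + s * y| <= h -> `|c * y - s * x| <= l -> `|x| <= l + h /\ `|y| <= l + h.
  move=> cs c_ s_ hh ll.
  have ex : x = c * (c * x + s * y) - s * (c * y - s * x).
    by transitivity ((c ^+ 2 + s ^+ 2) * x); [rewrite cs mul1r|ring].
  have ey : y = s * (c * x + s * y) + c * (c * y - s * x).
    by transitivity ((c ^+ 2 + s ^+ 2) * y); [rewrite cs mul1r|ring].
  split.
    rewrite ex (le_trans (ler_normB _ _))// !normrM addrC lerD//.
      by rewrite -[leRHS]mul1r ler_pM.
    by rewrite -[leRHS]mul1r ler_pM.
  rewrite ey (le_trans (ler_normD _ _))// !normrM addrC lerD//.
    by rewrite -[leRHS]mul1r ler_pM.
  by rewrite -[leRHS]mul1r ler_pM.
have strip (s w b : R) (A : set R) : 2^-1 <= `|s| ->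
    (forall y, A y -> `|w + s * (y - b)| <= h) ->
    (lebesgue_measure A <= (4 * h)%:E)%E.
  move=> s2 sA; pose m := b - w / s.
  have s0 : s != 0 by rewrite -normr_gt0; lra.
  apply: (@le_trans _ _ (lebesgue_measure `[m - 2 * h, m + 2 * h])).
    rewrite /lebesgue_measure; apply: le_outer_measure => y /sA Ay /=.
    rewrite in_itv/=.
    have : `|y - m| <= 2 * h.
      have -> : y - m = (w + s * (y - b)) / s by rewrite /m; field.
      rewrite normrM normfV ler_pdivrMr ?normr_gt0//.
      by apply: le_trans Ay _; nra.
    by rewrite ler_norml => /andP[? ?]; apply/andP; split; lra.
  rewrite lebesgue_measure_itv/= lte_fin; case: ltP => _.
    by rewrite -EFinB lee_fin; lra.
  by rewrite lee_fin; nra.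
have -> : 8 * h * (l + h) = 4 * h * ((l + h) *+ 2) by rewrite -mulr_natl; ring.
have [s2|s2] := leP 2^-1 `|sin t|.
  apply: (@area_le_xsection _ _ z.1); rewrite ?addr_ge0 ?mulr_ge0//.
  - exact: measurable_rect.
  - by move=> x [/bound b1 /b1 []].
  - move=> x; apply: (strip (sin t) (cos t * (x - z.1)) z.2) => // y.
    by rewrite /xsection/= inE => -[].
have {}s2 : 2^-1 <= `|cos t|.
  rewrite leNgt; apply/negP => h1.
  move: c2 (normr_ge0 (cos t)) (normr_ge0 (sin t)).
  rewrite -(real_normK (num_real (cos t))) -(real_normK (num_real (sin t))).
  by nra.
apply: (@area_le_ysection _ _ z.2); rewrite ?addr_ge0 ?mulr_ge0//.
- exact: measurable_rect.
- by move=> x [/bound b1 /b1 []].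
- move=> y; apply: (strip (cos t) (sin t * (y - z.2)) z.1) => // x.
  by rewrite /ysection/= inE addrC => -[].
Qed.

(** The area bound is asked of a measurable set around a whole neighbourhood of [A],
so that it passes to all sets close to [A] ([cov_nbhd]). Bounds on the area of [A]
alone would not survive the perturbations of paths below. *)
Definition cov A a :=
  exists2 e, 0 < e & exists U, [/\ measurable U, nbhd A e `<=` U & (area U <= a%:E)%E].

Lemma covS A B a b : A `<=` B -> a <= b -> cov B a -> cov A b.
Proof.
move=> AB ab [e e0 [U [mU AU Ua]]]; exists e => //; exists U; split => //.
  by apply: subset_trans AU; exact: nbhdS.
by rewrite (le_trans Ua)// lee_fin.
Qed.

Lemma cov0 : cov set0 0.
Proof.
exists 1 => //; exists set0; split => //; first by move=> x [].
by rewrite /area measure0.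
Qed.

Lemma covU A B a b : cov A a -> cov B b -> cov (A `|` B) (a + b).
Proof.
move=> [d d0 [U [mU AU Ua]]] [e e0 [V [mV BV Vb]]].
exists (Num.min d e); first by rewrite lt_min d0.
exists (U `|` V); split; first exact: measurableU.
- move=> x [y [Ay|By] xy]; [left; apply: AU|right; apply: BV]; exists y => //.
    by rewrite (le_trans xy)// ge_min lexx.
  by rewrite (le_trans xy)// ge_min lexx orbT.
- apply: (@le_trans _ _ (area U + area V)%E).
    by rewrite /area measureU2.
  by rewrite EFinD leeD.
Qed.

Lemma cov_bigcup (F : nat -> set (R * R)) (a : R) n :
  (forall i, (i < n)%N -> cov (F i) a) -> cov (\bigcup_(i in `I_n) F i) (n%:R * a).
Proof.
elim: n => [_|n IH Fa]; first by rewrite II0 bigcup_set0 mul0r; exact: cov0.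
apply: (@covS _ ((\bigcup_(i in `I_n) F i) `|` F n) (n%:R * a + a)).
- move=> x [i /= + Fx]; rewrite ltnS leq_eqVlt => /orP[/eqP <-|lin]; first by right.
  by left; exists i.
- by rewrite -natr1 mulrDl mul1r.
- by apply: covU; [apply: IH => i /ltnW; exact: Fa|exact: Fa].
Qed.

Lemma cov_nbhd A a : cov A a -> exists2 e, 0 < e & cov (nbhd A e) a.
Proof.
move=> [e e0 [U [mU AU Ua]]]; exists (e / 2); first by rewrite divr_gt0.
exists (e / 2); first by rewrite divr_gt0.
exists U; split => // x /nbhdD; rewrite -splitr; exact: AU.
Qed.

Lemma cov_area A a : cov A a -> (area A <= a%:E)%E.
Proof.
move=> [e /ltW e0 [U [mU AU Ua]]]; apply: le_trans Ua.
by apply: area_le => // x Ax; apply: AU; exact: sub_nbhd.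
Qed.

Lemma cov_rect z t l h : 0 <= l -> 0 < h ->
  cov (rect z t l h) (16 * h * (l + 3 * h)).
Proof.
move=> l0 h0; exists (h / 2); first by rewrite divr_gt0.
exists (rect z t (l + h) (2 * h)); split; first exact: measurable_rect.
- move=> x [y [h1 h2] xy].
  have [x1 x2 _] := norm_pair (x - y).
  have {}x1 : `|x.1 - y.1| <= h / 2 by exact: le_trans xy.
  have {}x2 : `|x.2 - y.2| <= h / 2 by exact: le_trans xy.
  have c1 := cos_max t; have s1 := sin_max t.
  split.
    have -> : cos t * (x.1 - z.1) + sin t * (x.2 - z.2) =
      (cos t * (y.1 - z.1) + sin t * (y.2 - z.2)) +
      (cos t * (x.1 - y.1) + sin t * (x.2 - y.2)) by ring.
    rewrite (le_trans (ler_normD _ _))// mulr2n mulrDl !mul1r lerD//.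
    rewrite (le_trans (ler_normD _ _))// [leRHS]splitr !normrM lerD//.
      by rewrite -[leRHS]mul1r ler_pM.
    by rewrite -[leRHS]mul1r ler_pM.
  have -> : cos t * (x.2 - z.2) - sin t * (x.1 - z.1) =
    (cos t * (y.2 - z.2) - sin t * (y.1 - z.1)) +
    (cos t * (x.2 - y.2) - sin t * (x.1 - y.1)) by ring.
  rewrite (le_trans (ler_normD _ _))// lerD//.
  rewrite (le_trans (ler_normB _ _))// [leRHS]splitr !normrM lerD//.
    by rewrite -[leRHS]mul1r ler_pM.
  by rewrite -[leRHS]mul1r ler_pM.
- have l1 : 0 <= l + h by lra.
  have h1 : 0 <= 2 * h by lra.
  by apply: (le_trans (area_rect z t l1 h1)); rewrite lee_fin; nra.
Qed.

End rectangles.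

(** * The area swept by a segment of circles *)

Section circle_families.
Context {R : realType}.
Local Notation V := ((R * R) * R)%type.
Implicit Types (p u : V) (A : set V) (S : set R) (t d e M B : R).

(** The triple [p] stands for the circle with centre [p.1] and radius [p.2]. *)
Definition pt p t : R * R := (p.1.1 + p.2 * cos t, p.1.2 + p.2 * sin t).

(** The component along the outer normal at angle [t] of the velocity of [pt p t],
when [p] has velocity [u]; it does not depend on [p]. *)
Definition speed t u : R := u.2 + u.1.1 * cos t + u.1.2 * sin t.

Definition seg p u : set V := [set x | exists2 s, 0 <= s <= 1 & x = p + s *: u].

Definition reg A S : set (R * R) :=
  [set z | exists2 p, A p & exists2 t, S t & z = pt p t].

Lemma normV_coord u : [/\ `|u.1.1| <= `|u|, `|u.1.2| <= `|u| & `|u.2| <= `|u|].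
Proof.
have [u1 u2 _] := norm_pair u; have [u11 u12 _] := norm_pair u.1.
by split => //; apply: le_trans u1.
Qed.

Lemma normV_le u e : `|u.1.1| <= e -> `|u.1.2| <= e -> `|u.2| <= e -> `|u| <= e.
Proof.
move=> h1 h2 h3; have [_ _ H] := norm_pair u; have [_ _ H1] := norm_pair u.1.
by apply: H => //; exact: H1.
Qed.

Lemma norm_speed t u : `|speed t u| <= 3 * `|u|.
Proof.
have [h1 h2 h3] := normV_coord u.
rewrite (_ : 3 = 1 + 1 + 1); last by ring.
rewrite !mulrDl !mul1r (le_trans (ler_normD _ _))// lerD//.
  rewrite (le_trans (ler_normD _ _))// lerD// normrM -[leRHS]mulr1.
  by rewrite ler_pM// cos_max.
by rewrite normrM -[leRHS]mulr1 ler_pM// sin_max.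
Qed.

Lemma speed_lip s t u : `|speed s u - speed t u| <= 2 * `|s - t| * `|u|.
Proof.
have [h1 h2 h3] := normV_coord u.
have -> : speed s u - speed t u =
  u.1.1 * (cos s - cos t) + u.1.2 * (sin s - sin t) by rewrite /speed; ring.
rewrite (le_trans (ler_normD _ _))// -mulrA mulr_natl mulr2n !normrM lerD// mulrC ler_pM//.
  exact: cos_lip.
exact: sin_lip.
Qed.

Lemma speedD t u v : speed t (u + v) = speed t u + speed t v.
Proof. by rewrite /speed/=; ring. Qed.

Lemma speedZ t (a : R) u : speed t (a *: u) = a * speed t u.
Proof. by rewrite /speed/= /GRing.scale/=; ring. Qed.

Lemma pt_lip t p q : `|pt p t - pt q t| <= 2 * `|p - q|.
Proof.
have [h1 h2 h3] := normV_coord (p - q).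
have [_ _] := norm_pair (pt p t - pt q t); apply.
  rewrite /= (_ : _ - _ = (p.1.1 - q.1.1) + (p.2 - q.2) * cos t); last by ring.
  rewrite (le_trans (ler_normD _ _))// mulr_natl mulr2n lerD//.
  by rewrite normrM -[leRHS]mulr1 ler_pM// cos_max.
rewrite /= (_ : _ - _ = (p.1.2 - q.1.2) + (p.2 - q.2) * sin t); last by ring.
rewrite (le_trans (ler_normD _ _))// mulr_natl mulr2n lerD//.
by rewrite normrM -[leRHS]mulr1 ler_pM// sin_max.
Qed.

Lemma reg_nbhd A S e : reg (nbhd A e) S `<=` nbhd (reg A S) (2 * e).
Proof.
move=> _ [p [q Aq pq] [t St ->]]; exists (pt q t); first by exists q => //; exists t.
by rewrite (le_trans (pt_lip _ _ _))// ler_pM2l.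
Qed.

Lemma regS A A' S S' : A `<=` A' -> S `<=` S' -> reg A S `<=` reg A' S'.
Proof. by move=> AA SS x [p /AA Ap [t /SS St ->]]; exists p => //; exists t. Qed.

Lemma regUl A A' S : reg (A `|` A') S `<=` reg A S `|` reg A' S.
Proof. by move=> x [p [Ap|Ap] [t St ->]]; [left|right]; exists p => //; exists t. Qed.

(** To first order the piece moves by [speed t u] along the normal; turning by an
angle at most [d] changes the normal coordinate only to second order. *)
Lemma reg_cell M p u t d : 0 <= d -> (forall x, seg p u x -> `|x.2| <= M) ->
  reg (seg p u) `[t, t + d] `<=`
  rect (pt p t) t (2 * `|u| + M * d) (`|speed t u| + M * d ^+ 2).
Proof.
move=> d0 pM _ [q sq [th + ->]]; rewrite /= in_itv/= => /andP[th1 th2].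
have qM := pM _ sq; have [s /andP[s0 s1] qE] := sq.
have [h1 h2 h3] := normV_coord u.
have [a th_a] : exists a, th = t + a by exists (th - t); rewrite addrC subrK.
have a0 : 0 <= a by lra.
have ad : a <= d by lra.
have sN : `|s| <= 1 by rewrite ger0_norm.
have q2 : q.2 = p.2 + s * u.2 by rewrite qE.
have c2 := cos2Dsin2 t.
split.
  have -> : cos t * ((pt q th).1 - (pt p t).1) + sin t * ((pt q th).2 - (pt p t).2) =
      s * speed t u + q.2 * (cos a - 1).
    rewrite /pt/= q2 qE/= th_a cosD sinD /speed /GRing.scale/=.
    transitivity (s * (u.2 + u.1.1 * cos t + u.1.2 * sin t)
      + ((p.2 + s * u.2) * cos a - p.2) * (cos t ^+ 2 + sin t ^+ 2) - s * u.2); first by ring.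
    by rewrite c2; ring.
  rewrite (le_trans (ler_normD _ _))// !normrM lerD//.
    by rewrite -[leRHS]mul1r ler_pM.
  rewrite ler_pM// distrC ger0_norm ?subr_ge0 ?cos_le1//.
  by rewrite (le_trans (one_minus_cos_le _))// lerXn2r// nnegrE.
have -> : cos t * ((pt q th).2 - (pt p t).2) - sin t * ((pt q th).1 - (pt p t).1) =
    s * (u.1.2 * cos t - u.1.1 * sin t) + q.2 * sin a.
  rewrite /pt/= q2 qE/= th_a cosD sinD /GRing.scale/=.
  transitivity (s * (u.1.2 * cos t - u.1.1 * sin t)
      + ((p.2 + s * u.2) * sin a) * (cos t ^+ 2 + sin t ^+ 2)); first by ring.
  by rewrite c2; ring.
rewrite (le_trans (ler_normD _ _))// !normrM lerD//.
  rewrite -[leRHS]mul1r ler_pM// (le_trans (ler_normB _ _))// mulr_natl mulr2n.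
  by rewrite !normrM lerD// -[leRHS]mulr1 ler_pM// ?cos_max ?sin_max.
by rewrite ler_pM// (le_trans (sin_le_norm _))// ger0_norm.
Qed.

(** The intervals are closed, so that the last one accounts for [x = n]. *)
Lemma split_nat (x : R) (n : nat) : (0 < n)%N -> 0 <= x <= n%:R ->
  exists2 i : nat, (i < n)%N & i%:R <= x <= i%:R + 1.
Proof.
elim: n => // n IH _ /andP[x0]; rewrite -natr1 => xn.
have [nx|xn'] := leP n%:R x; first by exists n => //; rewrite nx.
have n0 : (0 < n)%N by rewrite lt0n; apply/eqP => n0; rewrite n0 in xn'; lra.
have [|i iN ix] := IH n0; first by rewrite x0 ltW.
by exists i => //; rewrite ltnS ltnW.
Qed.

Lemma split_seg p u n : (0 < n)%N ->
  seg p u `<=` \bigcup_(i in `I_n) seg (p + (i%:R / n%:R) *: u) (n%:R^-1 *: u).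
Proof.
move=> n0 _ [s /andP[s0 s1] ->].
have n1 : 0 < n%:R :> R by rewrite ltr0n.
have [|i iN /andP[i1 i2]] := @split_nat (s * n%:R) n n0.
  apply/andP; split; first by rewrite mulr_ge0// ltW.
  by rewrite ler_piMl// ltW.
exists i => //; exists (s * n%:R - i%:R); first by apply/andP; split; lra.
rewrite -addrA scalerA -scalerDl; congr (_ + _ *: _).
by field; rewrite gt_eqF.
Qed.

Lemma seg_sub_part p u n i : (i < n)%N ->
  seg (p + (i%:R / n%:R) *: u) (n%:R^-1 *: u) `<=` seg p u.
Proof.
move=> iN _ [s /andP[s0 s1] ->]; exists (i%:R / n%:R + s / n%:R).
  have n1 : 0 < n%:R :> R by rewrite ltr0n (leq_ltn_trans _ iN).
  have : i%:R + 1 <= n%:R :> R by rewrite natr1 ler_nat.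
  rewrite -mulrDl => h; rewrite divr_ge0 ?addr_ge0 ?ler0n//= ler_pdivrMr//; lra.
by rewrite scalerA -addrA -scalerDl.
Qed.

Lemma split_itv t d n : 0 <= d -> (0 < n)%N ->
  `[t, t + d]%classic `<=` \bigcup_(j in `I_n)
    `[t + j%:R / n%:R * d, t + j%:R / n%:R * d + d / n%:R]%classic.
Proof.
move=> d0 n0 x /=; rewrite in_itv/= => /andP[x1 x2].
have n1 : 0 < n%:R :> R by rewrite ltr0n.
have [d_0|dn0] := eqVneq d 0.
  by exists 0%N => //=; rewrite in_itv/= d_0 !mulr0 !mul0r !addr0; lra.
have dp : 0 < d by rewrite lt_neqAle eq_sym dn0.
have [|i iN /andP[i1 i2]] := @split_nat ((x - t) / d * n%:R) n n0.
  apply/andP; split.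
    by rewrite mulr_ge0 ?ler0n// divr_ge0//; lra.
  by rewrite ler_piMl ?ler0n// ler_pdivrMr//; lra.
have i1' : i%:R / n%:R * d <= x - t.
  by rewrite mulrAC ler_pdivrMr// mulrC -ler_pdivlMl// mulrC mulrAC.
have i2' : x - t <= (i%:R + 1) / n%:R * d.
  by rewrite mulrAC ler_pdivlMr// [leRHS]mulrC -ler_pdivrMl// mulrC mulrAC.
exists i => //=; rewrite in_itv/=; apply/andP; split; first by lra.
by move: i2'; rewrite mulrDl mulrDl mul1r (mulrC n%:R^-1 d); lra.
Qed.

(** Up to a constant factor, the area swept over [t, t + d] is at most the arc length
[M * d] times the largest normal speed [B]. The bound is obtained by cutting the segment into [k ^ 3] pieces
and the angles into [k ^ 2] cells: the pieces are then much shorter than the cells,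
while the square of the length of a cell is negligible with respect to the length of
a piece, so that the errors of [reg_cell] disappear for large [k]. *)
Lemma seg_cov M p u t d B e : 0 < M -> 0 < d -> 0 < e ->
  (forall x, seg p u x -> `|x.2| <= M) ->
  (forall s, t <= s <= t + d -> `|speed s u| <= B) ->
  cov (reg (seg p u) `[t, t + d]) (16 * M * d * B + e).
Proof.
move=> M0 d0 e0 pM uB.
have B0 : 0 <= B by apply: le_trans (uB t _); rewrite ?lexx//; lra.
pose G := 2 * `|u| + 3 * B + 3 * M * d ^+ 2.
have G0 : 0 <= G by rewrite !addr_ge0// ?mulr_ge0// ?sqr_ge0// ltW.
(* [H / k] bounds the excess over [16 * M * d * B] when the cutting is done with [k] *)
pose H := 16 * (B * G + M ^+ 2 * d ^+ 3 + M * d ^+ 2 * G).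
have H0 : 0 <= H.
  by rewrite mulr_ge0// !addr_ge0// ?mulr_ge0// ?exprn_ge0// ltW.
have [k k0 Hk] : exists2 k : nat, (0 < k)%N & H / k%:R <= e.
  exists (Num.truncn (H / e)).+1 => //.
  by rewrite ler_pdivrMr ?ltr0n// mulrC -ler_pdivrMr// ltW// truncnS_gt.
have k1 : 0 < k%:R :> R by rewrite ltr0n.
pose n := (k ^ 3)%N; pose m := (k ^ 2)%N.
have n0 : (0 < n)%N by rewrite expn_gt0 k0.
have m0 : (0 < m)%N by rewrite expn_gt0 k0.
have n1 : 0 < n%:R :> R by rewrite ltr0n.
have m1 : 0 < m%:R :> R by rewrite ltr0n.
pose h := B / n%:R + M * (d / m%:R) ^+ 2.
pose l := 2 * `|u| / n%:R + M * (d / m%:R).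
have h0 : 0 < h.
  apply: ltr_wpDl; first by rewrite divr_ge0// ltW.
  by rewrite mulr_gt0// exprn_gt0// divr_gt0.
have l0 : 0 <= l.
  apply: addr_ge0; first by rewrite divr_ge0// ?mulr_ge0// ltW.
  by rewrite mulr_ge0 ?divr_ge0// ltW.
have cell i j : (i < n)%N -> (j < m)%N ->
    cov (reg (seg (p + (i%:R / n%:R) *: u) (n%:R^-1 *: u))
      `[t + j%:R / m%:R * d, t + j%:R / m%:R * d + d / m%:R]) (16 * h * (l + 3 * h)).
  move=> iN jm.
  have jm1 : j%:R / m%:R <= 1 :> R by rewrite ler_pdivrMr// mul1r ler_nat ltnW.
  have jm0 : 0 <= j%:R / m%:R :> R by rewrite divr_ge0.
  apply: (covS (B := rect (pt (p + (i%:R / n%:R) *: u) (t + j%:R / m%:R * d))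
     (t + j%:R / m%:R * d) l h) _ (lexx _)); last exact: cov_rect.
  apply: subset_trans (reg_cell _ _) _.
  - by rewrite divr_ge0// ltW.
  - by move=> x /(seg_sub_part iN); exact: pM.
  - have nu : `|n%:R^-1 *: u| = `|u| / n%:R.
      by rewrite normrZ ger0_norm ?invr_ge0 ?(ltW n1)// mulrC.
    have sB : `|speed (t + j%:R / m%:R * d) (n%:R^-1 *: u)| <= B / n%:R.
      rewrite speedZ normrM ger0_norm ?invr_ge0 ?(ltW n1)// mulrC ler_pM2r ?invr_gt0//.
      by apply: uB; apply/andP; split; nra.
    move=> x [x1 x2]; split; [apply: le_trans x1 _|apply: le_trans x2 _].
      by rewrite lerD2r.
    by rewrite nu mulrA.
apply: (covS (a := n%:R * (m%:R * (16 * h * (l + 3 * h))))); last first.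
- apply: cov_bigcup => i iN; apply: cov_bigcup => j jm; exact: (cell i j iN jm).
- have nk : n%:R = k%:R ^+ 3 :> R by rewrite natrX.
  have mk : m%:R = k%:R ^+ 2 :> R by rewrite natrX.
  pose c := k%:R^-1 : R.
  have c0 : 0 <= c by rewrite invr_ge0 ltW.
  have c1 : c <= 1 by rewrite invf_le1// ler1n.
  have -> : n%:R * (m%:R * (16 * h * (l + 3 * h))) =
    16 * ((B + M * d ^+ 2 * c) * (M * d + 2 * `|u| * c + 3 * c * (B + M * d ^+ 2 * c))).
    by rewrite /h /l nk mk /c; field; rewrite gt_eqF.
  have hc : H * c <= e by [].
  have : 3 * c * (B + M * d ^+ 2 * c) <= 3 * c * (B + M * d ^+ 2).
    rewrite ler_wpM2l ?mulr_ge0// lerD2l ler_piMr// mulr_ge0// ?sqr_ge0// ltW//.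
  move=> h3.
  have : (B + M * d ^+ 2 * c) * (M * d + 2 * `|u| * c + 3 * c * (B + M * d ^+ 2 * c))
     <= (B + M * d ^+ 2 * c) * (M * d + G * c).
    rewrite ler_wpM2l//; last by rewrite /G; lra.
    by rewrite addr_ge0// !mulr_ge0// ?sqr_ge0// ltW.
  have : M * d ^+ 2 * G * (c * c) <= M * d ^+ 2 * G * c.
    rewrite ler_wpM2l//; last by rewrite ler_piMr.
    by rewrite mulr_ge0// mulr_ge0 ?sqr_ge0// ltW.
  move: hc; rewrite /H; move: (G) => g; clear -h3; nra.
- move=> z [q /(split_seg n0) [i iN qi] [s /(split_itv (ltW d0) m0) [j jm sj] ->]].
  by exists i => //; exists j => //; exists q => //; exists s.
Qed.

End circle_families.

(** * Paths of circles with one hidden block *)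

Section routes.
Context {R : realType}.
Local Notation V := ((R * R) * R)%type.

(** A polygonal path in which each segment carries a label [h]; along it the block
[h] will be hidden. [T h] only has to contain the segments labelled [h], which makes
paths easy to concatenate and to refine. *)
Inductive route (L : Type) (T : L -> set V) : V -> V -> Prop :=
| route_nil p : route T p p
| route_seg h p q : seg p (q - p) `<=` T h -> route T p q
| route_cat p q r : route T p q -> route T q r -> route T p r.

Lemma route_sub (L L' : Type) (T : L -> set V) (T' : L' -> set V) p q :
  (forall h, exists h', T h `<=` T' h') -> route T p q -> route T' p q.
Proof.
move=> TT'; elim=> {p q} [p|h p q pq|p q r _ IH1 _ IH2].
- exact: route_nil.
- have [h' hh'] := TT' h; apply: (@route_seg _ _ h').
  exact: subset_trans hh'.
- exact: route_cat IH1 IH2.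
Qed.

(** With two blocks the label records the block that is exposed, instead of the
hidden one: [T true] is seen by the angles of [S true] only. *)
Definition cost (S : bool -> set R) (T : bool -> set V) : set (R * R) :=
  reg (T true) (S true) `|` reg (T false) (S false).

Definition crossing (S : bool -> set R) p q (A : set V) (c : R) : Prop :=
  exists T : bool -> set V,
    [/\ route T p q, (forall b, T b `<=` A) & cov (cost S T) c].

Lemma crossing_nil S p A : crossing S p p A 0.
Proof.
exists (fun=> set0); split=> //; first exact: route_nil.
  by move=> _ x [].
by apply: (covS _ (lexx _) cov0) => x [|] [y].
Qed.

Lemma crossing_cat S p q r A c d :
  crossing S p q A c -> crossing S q r A d -> crossing S p r A (c + d).
Proof.
move=> [T [pq TA Tc]] [T' [qr TA' Tc']].
exists (fun b => T b `|` T' b); split.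
- apply: (@route_cat _ _ p q r); [apply: route_sub pq|apply: route_sub qr].
    by move=> b; exists b; exact: subsetUl.
  by move=> b; exists b; exact: subsetUr.
- by move=> b; rewrite subUset; split; [exact: TA|exact: TA'].
- apply: (covS _ (lexx _) (covU Tc Tc')).
  move=> x [/regUl[]|/regUl[]] H; by [left; left|right; left|left; right|right; right].
Qed.

Lemma crossingS S p q A B c d : A `<=` B -> c <= d ->
  crossing S p q A c -> crossing S p q B d.
Proof.
move=> AB cd [T [pq TA Tc]]; exists T; split => //.
  by move=> b; apply: subset_trans AB; exact: TA.
exact: covS Tc.
Qed.

Lemma crossing_sym S p q A c :
  crossing (S \o negb) p q A c -> crossing S p q A c.
Proof.
move=> [T [pq TA Tc]]; exists (T \o negb); split.
- by apply: route_sub pq => h; exists (~~ h); rewrite /= negbK.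
- by move=> b; exact: TA.
- by apply: covS (lexx _) Tc; rewrite /cost/= setUC.
Qed.

Lemma crossing_hidden S p q A b : S b = set0 -> seg p (q - p) `<=` A ->
  crossing S p q A 0.
Proof.
move=> Sb pqA; exists (fun b' => if b' == b then seg p (q - p) else set0); split.
- by apply: (@route_seg _ _ b); rewrite eqxx.
- by move=> b'; case: ifP => // _; exact: sub0set.
- apply: (covS _ (lexx _) cov0).
  by case: b Sb => Sb x [|] [y] //= _ [t]; rewrite Sb.
Qed.

Definition safe (M : R) (A : set V) (e : R) := forall x, A x -> `|x.2| + e <= M.

Lemma safe_nbhd M A d e : safe M A (d + e) -> safe M (nbhd A d) e.
Proof.
move=> sA x [y Ay xy]; have [_ _ h] := normV_coord (x - y).
have := sA _ Ay.
have : `|x.2| <= `|y.2| + `|x.2 - y.2| by rewrite addrC -{1}(subrK y.2 x.2) ler_normD.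
move: h => /= h; lra.
Qed.

Lemma safeS M A B e : A `<=` B -> safe M B e -> safe M A e.
Proof. by move=> AB sB x /AB; exact: sB. Qed.

(** Velocities in [Q] can be followed at cost [a] per unit length, by paths as close
to the straight one as desired. The segment has to keep a margin inside the region
where the radius is at most [M], for area estimates depend on [M]. *)
Definition crossable (M : R) (S : bool -> set R) (Q : set V) (a : R) : Prop :=
  forall p u d e, Q u -> 0 < d -> 0 < e -> safe M (seg p u) d ->
    crossing S p (p + u) (nbhd (seg p u) d) (a * `|u| + e).

Lemma crossable_sym M S Q a : crossable M (S \o negb) Q a -> crossable M S Q a.
Proof. by move=> SQ p u d e *; apply: crossing_sym; exact: SQ. Qed.

Lemma seg_start p (u : V) : seg p u p.
Proof. by exists 0; rewrite ?lexx ?ler01// scale0r addr0. Qed.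

(** The segment is followed in [n] steps, each of them split into a step along [u1]
and a step along [u2]; for large [n] this stays close to the segment, and the two
kinds of steps are then replaced by the cheap paths that are available for them. *)
Lemma zigzag M S Q1 Q2 a1 a2 p u u1 u2 d e :
  crossable M S Q1 a1 -> crossable M S Q2 a2 ->
  (forall c, 0 < c -> Q1 (c *: u1)) -> (forall c, 0 < c -> Q2 (c *: u2)) ->
  u = u1 + u2 -> 0 < d -> 0 < e -> safe M (seg p u) d ->
  crossing S p (p + u) (nbhd (seg p u) d) (a1 * `|u1| + a2 * `|u2| + e).
Proof.
move=> H1 H2 Qu1 Qu2 uE d0 e0 sd.
have [n n0 nd] : exists2 n : nat, (0 < n)%N & `|u1| / n%:R <= d / 2.
  exists (Num.truncn (`|u1| / (d / 2))).+1 => //.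
  rewrite ler_pdivrMr ?ltr0n// mulrC -ler_pdivrMr ?divr_gt0//.
  by rewrite ltW// truncnS_gt.
have n1 : 0 < n%:R :> R by rewrite ltr0n.
have ni : 0 < n%:R^-1 :> R by rewrite invr_gt0.
pose v1 := n%:R^-1 *: u1; pose v2 := n%:R^-1 *: u2.
have nv1 : `|v1| = `|u1| / n%:R by rewrite normrZ gtr0_norm// mulrC.
have nv2 : `|v2| = `|u2| / n%:R by rewrite normrZ gtr0_norm// mulrC.
(* the start of the step number [k] *)
pose P k := p + (k%:R / n%:R) *: u.
have PS k : P k.+1 = P k + v1 + v2.
  rewrite /P -addrA -[RHS]addrA -natr1 mulrDl mul1r scalerDl; congr (_ + (_ + _)).
  by rewrite uE scalerDr.
have d2 : 0 < d / 2 by rewrite divr_gt0.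
have onseg k s : (k < n)%N -> 0 <= s <= 1 -> seg p u (P k + s *: (v1 + v2)).
  move=> kn s01; apply: (seg_sub_part kn); exists s => //.
  by rewrite /v1 /v2 -(scalerDr n%:R^-1) -uE.
have near1 k : (k < n)%N -> seg (P k) v1 `<=` nbhd (seg p u) (d / 2).
  move=> kn _ [s /andP[s0 s1] ->]; exists (P k).
    by have := onseg k 0 kn; rewrite scale0r addr0; apply; rewrite lexx ler01.
  rewrite addrAC subrr add0r normrZ ger0_norm// nv1 (le_trans _ nd)//.
  by rewrite ler_piMl.
have near2 k : (k < n)%N -> seg (P k + v1) v2 `<=` nbhd (seg p u) (d / 2).
  move=> kn _ [s s01 ->]; exists (P k + s *: (v1 + v2)); first exact: onseg.
  have -> : P k + v1 + s *: v2 - (P k + s *: (v1 + v2)) = (1 - s) *: v1.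
    rewrite scalerDr scalerBl scale1r; apply/eqP; rewrite subr_eq; apply/eqP.
    by rewrite [RHS]addrCA [v1 - _ + _]addrA subrK addrA.
  case/andP: s01 => s0 s1.
  rewrite normrZ ger0_norm ?subr_ge0// nv1 (le_trans _ nd)//.
  by rewrite ler_piMl// gerBl.
have sub2 A : A `<=` nbhd (seg p u) (d / 2) ->
    nbhd A (d / 2) `<=` nbhd (seg p u) d /\ safe M A (d / 2).
  move=> AB; split; first by apply: subset_trans (nbhdS AB) _; rewrite {3}(splitr d); exact: nbhdD.
  by apply: (safeS AB); apply: safe_nbhd; rewrite -splitr.
have en : 0 < e / n%:R / 2 by rewrite !divr_gt0.
suff H k : (k <= n)%N -> crossing S p (P k) (nbhd (seg p u) d)
    (k%:R * (a1 * `|v1| + a2 * `|v2| + e / n%:R)).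
  have -> : p + u = P n by rewrite /P divff ?gt_eqF// scale1r.
  apply: crossingS (H n _) => //.
  rewrite nv1 nv2 !mulrDr le_eqVlt; apply/orP; left; apply/eqP; field.
  by rewrite gt_eqF.
elim: k => [_|k IH kn].
  by rewrite mul0r /P mul0r scale0r addr0; exact: crossing_nil.
rewrite -natr1 mulrDl mul1r; apply: crossing_cat (IH (ltnW kn)) _.
have -> : a1 * `|v1| + a2 * `|v2| + e / n%:R =
  (a1 * `|v1| + e / n%:R / 2) + (a2 * `|v2| + e / n%:R / 2).
  by field; rewrite gt_eqF.
rewrite PS.
have [s1 s1'] := sub2 _ (near1 _ kn); have [s2 s2'] := sub2 _ (near2 _ kn).
apply: (@crossing_cat _ _ (P k + v1)).
  by apply: (crossingS s1 (lexx _)); apply: H1 => //; exact: Qu1.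
by apply: (crossingS s2 (lexx _)); apply: H2 => //; exact: Qu2.
Qed.

End routes.

(** * Two blocks of angles *)

Section two_blocks.
Context {R : realType}.
Local Notation V := ((R * R) * R)%type.

Definition still (t : R) : set V := [set u | speed t u = 0].

Lemma stillZ t c u : still t u -> still t (c *: u).
Proof. by rewrite /still/= speedZ => ->; rewrite mulr0. Qed.

(** The functionals [speed s] and [speed t] are linearly independent, with a
quantitative bound in terms of [1 - cos (s - t)]. The witness [w] below lies in the
kernel of [speed t] and has [speed s w = 1]: it moves in the direction of angle [s]
and changes the radius so as to be still at [t]. *)
Lemma still_decomp (sigma s t : R) (u : V) : 0 < sigma -> sigma <= 1 - cos (s - t) ->
  exists u1 u2 : V, [/\ u = u1 + u2, still t u1, still s u2,
    `|u1| <= (1 + 3 / sigma) * `|u| & `|u2| <= (1 + 3 / sigma) * `|u|].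
Proof.
move=> sg0 sg; pose k := 1 - cos (s - t).
have k0 : 0 < k by exact: lt_le_trans sg.
pose w : V := k^-1 *: ((cos s, sin s), - cos (s - t)).
have wt : speed t w = 0.
  by rewrite speedZ /speed/= cosB; apply/eqP; rewrite mulf_eq0; apply/orP; right; apply/eqP; ring.
have ws : speed s w = 1.
  rewrite speedZ /speed/= -addrA -!expr2 cos2Dsin2 addrC.
  by rewrite -/k mulVf// gt_eqF.
have nw : `|w| <= sigma^-1.
  rewrite normrZ gtr0_norm ?invr_gt0// -[leRHS]mulr1 ler_pM//.
  - by rewrite invr_ge0 ltW.
  - by rewrite lef_pV2// posrE.
  - by apply: normV_le; rewrite /= ?normrN ?cos_max ?sin_max.
clearbody w.
have n1 : `|speed s u *: w| <= 3 / sigma * `|u|.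
  by rewrite normrZ mulrAC ler_pM// norm_speed.
exists (speed s u *: w), (u - speed s u *: w); split.
- by rewrite addrC subrK.
- exact: stillZ.
- by rewrite /still/= speedD -scaleN1r !speedZ ws; ring.
- by apply: le_trans n1 _; rewrite ler_wpM2r// lerDr.
- rewrite (le_trans (ler_normB _ _))// mulrDl mul1r lerD2l.
  exact: n1.
Qed.

Lemma still_approx (s t d : R) (u : V) : still t u -> `|s - t| <= d ->
  exists u1 w : V, [/\ u = u1 + w, still s u1, `|w| <= 2 * d * `|u| &
    `|u1| <= (1 + 2 * d) * `|u|].
Proof.
(* it suffices to correct the radius, which moves all normals at speed 1 *)
move=> ut st; pose w : V := ((0, 0), speed s u).
have nw : `|w| <= 2 * d * `|u|.
  have n1 : `|speed s u| <= 2 * d * `|u|.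
    have := speed_lip s t u; rewrite [speed t u]ut subr0 => h; apply: le_trans h _.
    by rewrite ler_wpM2r// ler_wpM2l.
  by apply: normV_le; rewrite //= normr0 (le_trans _ n1).
exists (u - w), w; split => //.
- by rewrite subrK.
- by rewrite /still/= speedD -scaleN1r speedZ /w {2}/speed/=; ring.
- by rewrite (le_trans (ler_normB _ _))// mulrDl mul1r lerD2l.
Qed.

Section sweep.
Variables (M sigma : R).
Hypothesis M0 : 0 < M.
Hypothesis sigma0 : 0 < sigma.
Let C := 1 + 3 / sigma.

Let C0 : 0 <= C. Proof. by rewrite addr_ge0// divr_ge0// ltW. Qed.

Lemma crossable_all S s t a : 0 <= a -> sigma <= 1 - cos (s - t) ->
  crossable M S (still s) a -> crossable M S (still t) a ->
  crossable M S setT (2 * C * a).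
Proof.
move=> a0 st Hs Ht p u d e _ d0 e0 sd.
have [u1 [u2 [uE u1t u2s n1 n2]]] := still_decomp u sigma0 st.
apply: crossingS (zigzag Ht Hs _ _ uE d0 e0 sd) => //.
- have -> : 2 * C * a * `|u| = a * (C * `|u| + C * `|u|) by ring.
  by rewrite lerD2r -mulrDr ler_wpM2l// lerD.
- by move=> c _; exact: stillZ.
- by move=> c _; exact: stillZ.
Qed.

(** One step of the induction: the counted part of the second block grows by the
interval [t, t + d]. The quadratic term is the area swept over this interval by a
segment that is still at [t + d]; the factor of [a] pays for replacing it by a
velocity that is still at [t] and a small correction. *)
Lemma crossable_extend (S S' : bool -> set R) s t d a :
  0 <= a -> 0 < d -> sigma <= 1 - cos (s - t) ->
  S' true `<=` S true -> S' false `<=` S false `|` `[t, t + d] ->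
  crossable M S (still s) a -> crossable M S (still t) a ->
  crossable M S' (still (t + d)) (a * (1 + (2 + 4 * C) * d) + 32 * M * d ^+ 2).
Proof.
move=> a0 d0 st S1 S2 Hs Ht p u dl e ut dl0 e0 sd.
have Hall := crossable_all a0 st Hs Ht.
have [|u1 [w [uE u1t nw n1]]] := @still_approx t (t + d) d u ut.
  by rewrite opprD addrA subrr add0r normrN gtr0_norm.
have e2 : 0 < e / 2 by rewrite divr_gt0.
have pM x : seg p u x -> `|x.2| <= M.
  by move=> /sd; apply: le_trans; rewrite lerDl ltW.
have uB s' : t <= s' <= t + d -> `|speed s' u| <= 2 * d * `|u|.
  move=> /andP[h1 h2]; have := speed_lip s' (t + d) u.
  rewrite [X in speed _ u - X]ut subr0 => h; apply: le_trans h _.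
  rewrite ler_wpM2r// ler_wpM2l// ler0_norm; lra.
have [c c0 Zc] := cov_nbhd (seg_cov M0 d0 e2 pM uB).
(* [pt] doubles distances at most, hence [c / 2] *)
pose dl' := Num.min dl (c / 2).
have dl'0 : 0 < dl' by rewrite lt_min dl0 divr_gt0.
have sd' : safe M (seg p u) dl'.
  by move=> x /sd; apply: le_trans; rewrite lerD2l ge_min lexx.
have [||T [pq TA Tc]] := zigzag Ht Hall _ _ uE dl'0 e2 sd'.
- by move=> k _; exact: stillZ.
- by [].
exists T; split => //.
  by move=> b; apply: subset_trans (TA b) _; apply: nbhdW; rewrite ge_min lexx.
apply: covS (covU Tc Zc).
- move=> x [[y Ty [th /S1 th1 ->]]|[y Ty [th /S2 [th1|th1] ->]]].
  + by left; left; exists y => //; exists th.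
  + by left; right; exists y => //; exists th.
  + right; have : reg (nbhd (seg p u) dl') `[t, t + d] (pt y th).
      by exists y; [exact: (TA false)|exists th].
    move=> /reg_nbhd; apply: nbhdW.
    have : dl' <= c / 2 by rewrite ge_min lexx orbT.
    lra.
- have h1 : a * `|u1| <= a * ((1 + 2 * d) * `|u|) by rewrite ler_wpM2l.
  have h2 : 2 * C * a * `|w| <= 2 * C * a * (2 * d * `|u|).
    by rewrite ler_wpM2l// mulr_ge0// mulr_ge0.
  have -> : (a * (1 + (2 + 4 * C) * d) + 32 * M * d ^+ 2) * `|u| + e =
    a * ((1 + 2 * d) * `|u|) + 2 * C * a * (2 * d * `|u|) + e / 2 +
    (16 * M * d * (2 * d * `|u|) + e / 2) by field.
  by rewrite !lerD.
Qed.

Variables (s0 t0 d : R) (n : nat).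
Hypothesis d0 : 0 < d.
Hypothesis st_far : forall s t, s0 <= s <= s0 + n%:R * d -> t0 <= t <= t0 + n%:R * d ->
  sigma <= 1 - cos (s - t).

Let arcs (i j : nat) (b : bool) : set R :=
  if b then `[s0, s0 + i%:R * d[%classic else `[t0, t0 + j%:R * d[%classic.

Let lam := 3 + 4 * C.
(* a supersolution of the recursion of [crossable_extend], see [acc_step] *)
Let acc (m : nat) := 32 * M * d * (1 + lam * d) ^+ m.

Let lam0 : 0 <= lam. Proof. by rewrite addr_ge0// mulr_ge0. Qed.

Let base_ge1 : 1 <= 1 + lam * d. Proof. by rewrite lerDl mulr_ge0// ltW. Qed.

Let acc_ge m : 32 * M * d <= acc m.
Proof.
rewrite /acc ler_peMr ?exprn_ege1//.
by rewrite !mulr_ge0// ltW.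
Qed.

Let acc_ge0 m : 0 <= acc m.
Proof. by apply: le_trans (acc_ge m); rewrite !mulr_ge0// ltW. Qed.

Let acc_step m : acc m * (1 + (2 + 4 * C) * d) + 32 * M * d ^+ 2 <= acc m.+1.
Proof.
have -> : acc m.+1 = acc m * (1 + lam * d) by rewrite /acc exprSr mulrA.
have : 32 * M * d * d <= acc m * d by rewrite ler_wpM2r// ltW.
by rewrite /lam; nra.
Qed.

Lemma crossableW S Q a b : a <= b -> crossable M S Q a -> crossable M S Q b.
Proof.
move=> ab H p u dl e Qu dl0 e0 sd; apply: crossingS (H _ _ _ _ Qu dl0 e0 sd) => //.
by rewrite lerD2r ler_wpM2r.
Qed.

(** If the counted part of a block is empty, expose that block all the time. *)
Lemma crossable_hidden S Q a b : 0 <= a -> S b = set0 -> crossable M S Q a.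
Proof.
move=> a0 Sb p u dl e Qu dl0 e0 sd.
apply: (@crossingS _ S _ _ (seg p u) _ 0); last 1 first.
- by apply: (crossing_hidden Sb); rewrite addrC addKr.
- by apply: sub_nbhd; exact: ltW.
- by rewrite addr_ge0 ?mulr_ge0// ltW.
Qed.

Let step_itv (x : R) (j : nat) :
  `[x, x + j.+1%:R * d[%classic `<=`
  `[x, x + j%:R * d[ `|` `[x + j%:R * d, x + j%:R * d + d]%classic.
Proof.
move=> y /=; rewrite !in_itv/= -natr1 mulrDl mul1r => /andP[h1 h2].
by have [h|h] := ltP y (x + j%:R * d); [left; rewrite h1|right; lra].
Qed.

(** Each of the two statements at (i + 1, j + 1) follows from both statements at one
of the two preceding grid points, and at the border of the grid one counted part is
empty. *)
Lemma crossable_grid i j : (i <= n)%N -> (j <= n)%N ->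
  crossable M (arcs i j) (still (s0 + i%:R * d)) (acc (i + j)) /\
  crossable M (arcs i j) (still (t0 + j%:R * d)) (acc (i + j)).
Proof.
have far k l : (k <= n)%N -> (l <= n)%N ->
    sigma <= 1 - cos ((s0 + k%:R * d) - (t0 + l%:R * d)).
  move=> kn ln; apply: st_far.
    by rewrite lerDl mulr_ge0 ?(ltW d0)//= lerD2l ler_wpM2r ?(ltW d0)// ler_nat.
  by rewrite lerDl mulr_ge0 ?(ltW d0)//= lerD2l ler_wpM2r ?(ltW d0)// ler_nat.
have arc0 (x : R) : `[x, x + 0%:R * d[%classic = set0.
  apply/seteqP; split => // y /=; rewrite in_itv/= mul0r addr0; lra.
elim: i j => [j _ _|i IHi].
  by split; apply: (@crossable_hidden _ _ _ true) => //=; rewrite /arcs arc0.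
elim=> [_ _|j IHj iN jN].
  by split; apply: (@crossable_hidden _ _ _ false) => //=; rewrite /arcs arc0.
have [s1 t1] := IHj iN (ltnW jN).
have [s2 t2] := IHi j.+1 (ltnW iN) jN.
split.
- rewrite addSn -natr1 mulrDl mul1r addrA.
  apply: crossableW (acc_step _) _; apply: crossable_sym.
  apply: (@crossable_extend (arcs i j.+1 \o negb) _ (t0 + j.+1%:R * d)) => //.
  + by rewrite -cosN opprB; apply: far => //; exact: ltnW.
  + by rewrite /arcs/=; exact: step_itv.
  + by apply: crossable_sym => p u; exact: t2.
  + by apply: crossable_sym => p u; exact: s2.
- rewrite addnS -[in still _]natr1 mulrDl mul1r addrA.
  apply: crossableW (acc_step _) _.
  apply: (@crossable_extend (arcs i.+1 j) _ (s0 + i.+1%:R * d)) => //.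
  + by apply: far => //; exact: ltnW.
  + by rewrite /arcs/=; exact: step_itv.
Qed.

Lemma crossable_arcs : crossable M (arcs n n) setT (2 * C * acc (n + n)).
Proof.
have [h1 h2] := crossable_grid (leqnn n) (leqnn n).
apply: crossable_all h1 h2 => //; apply: st_far.
  by rewrite lerDl lexx mulr_ge0// ltW.
by rewrite lerDl lexx mulr_ge0// ltW.
Qed.

End sweep.

(** The cost given by [crossable_arcs] is proportional to the mesh [d], up to a
factor that stays bounded by an exponential. *)
Lemma two_arcs (M sigma s0 t0 b : R) (p u : V) dl e :
  0 < M -> 0 < sigma -> 0 < b ->
  (forall s t, s0 <= s <= s0 + b -> t0 <= t <= t0 + b -> sigma <= 1 - cos (s - t)) ->
  0 < dl -> 0 < e -> safe M (seg p u) dl ->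
  crossing (fun h : bool => if h then `[s0, s0 + b[%classic else `[t0, t0 + b[%classic)
    p (p + u) (nbhd (seg p u) dl) e.
Proof.
move=> M0 sg0 b0 far dl0 e0 sd.
pose C := 1 + 3 / sigma; pose lam := 3 + 4 * C.
have C0 : 0 <= C by rewrite addr_ge0// divr_ge0// ltW.
have lam0 : 0 <= lam by rewrite addr_ge0// mulr_ge0.
pose K := 2 * C * (32 * M * b * expR (2 * lam * b)) * `|u|.
have K0 : 0 <= K by rewrite !mulr_ge0 ?expR_ge0// ltW.
have [n n0 Kn] : exists2 n : nat, (0 < n)%N & K / n%:R <= e / 2.
  exists (Num.truncn (K / (e / 2))).+1 => //.
  rewrite ler_pdivrMr ?ltr0n// mulrC -ler_pdivrMr ?divr_gt0//.
  by rewrite ltW// truncnS_gt.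
have n1 : 0 < n%:R :> R by rewrite ltr0n.
pose d := b / n%:R.
have nd : n%:R * d = b by rewrite /d mulrC divfK// gt_eqF.
have d0 : 0 < d by rewrite divr_gt0.
have := @crossable_arcs M sigma M0 sg0 s0 t0 d n d0.
rewrite nd => /(_ far) /(_ p u dl (e / 2) I dl0 _ sd).
rewrite divr_gt0// => /(_ isT); apply: crossingS => //.
rewrite [leRHS]splitr lerD2r; apply: le_trans Kn.
rewrite -/C -/lam /K -[leRHS]mulrA [`|u| / _]mulrC [leRHS]mulrA ler_wpM2r//.
rewrite -[leRHS]mulrA ler_wpM2l ?mulr_ge0//.
have -> : 32 * M * b * expR (2 * lam * b) / n%:R = 32 * M * d * expR (2 * lam * b).
  by rewrite /d; field; rewrite gt_eqF.
rewrite ler_wpM2l ?mulr_ge0 ?(ltW M0) ?(ltW b0) ?invr_ge0 ?(ltW n1)//.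
have -> : 2 * lam * b = (n + n)%:R * (lam * d).
  by rewrite natrD -nd; ring.
rewrite expRM_natl lerXn2r ?nnegrE ?expR_ge0//.
  by rewrite addr_ge0// mulr_ge0// ltW.
exact: expR_ge1Dx.
Qed.

End two_blocks.

(** * All blocks of angles *)

Section many_blocks.
Context {R : realType}.
Local Notation V := ((R * R) * R)%type.

Section refinement.
Variables (L : finType) (M sigma b : R) (start : L -> R).
Hypotheses (M0 : 0 < M) (sigma0 : 0 < sigma) (b0 : 0 < b).
Hypothesis far : forall i j, i != j -> forall s t,
  start i <= s <= start i + b -> start j <= t <= start j + b ->
  sigma <= 1 - cos (s - t).

Let arc i : set R := `[start i, start i + b[%classic.

(** What the block [i] sees of a labelled path: all pieces during which it is not
hidden. *)
Definition seen (T : L -> set V) (i : L) : set V :=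
  \bigcup_(h in [set h | h != i]) T h.

(** Each piece with label [h <> k] is replaced by a path for the blocks [h] and [k];
[W] collects what these two blocks see of it. A third block [i] saw the old piece,
since [i <> h], so what it sees now is close to what it saw before. *)
Lemma hide_one_more (T : L -> set V) k p q d e : route T p q ->
  (forall h, safe M (T h) d) -> 0 < d -> 0 < e ->
  exists (T' : L -> set V) (W : set (R * R)), [/\ route T' p q,
    (forall h, T' h `<=` nbhd (\bigcup_h' T h') d), cov W e &
    forall i, reg (seen T' i) (arc i) `<=`
      (if i == k then set0 else reg (nbhd (seen T i) d) (arc i)) `|` W].
Proof.
move=> pq sT d0; elim: pq e => {p q} [p|h p q pqh|p q r _ IH1 _ IH2] e e0.
- exists (fun=> set0), set0; split.
  + exact: route_nil.
  + by move=> h; exact: sub0set.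
  + exact: covS (ltW e0) cov0.
  + by move=> i x [y [h]].
- have [hk|hk] := eqVneq h k.
    exists (fun h' => if h' == k then seg p (q - p) else set0), set0; split.
    + by apply: (@route_seg _ _ _ k); rewrite eqxx.
    + move=> h'; apply: subset_trans (sub_nbhd (ltW d0)).
      by case: ifP => // _; [exact: (subset_trans pqh (bigcup_sup I))|exact: sub0set].
    + exact: covS (ltW e0) cov0.
    + move=> i x [y [h' /= h'i]]; case: eqP => // h'k py [t ti ->].
      rewrite h'k eq_sym in h'i; rewrite (negbTE h'i); left; exists y; last by exists t.
      apply: sub_nbhd; first exact: ltW.
      by exists h; [rewrite /= hk eq_sym|exact: pqh].
  have sp : safe M (seg p (q - p)) d by apply: safeS (sT h).
  have [T2 [pq T2A T2c]] := two_arcs M0 sigma0 b0 (far hk) d0 e0 sp.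
  rewrite [p + _]addrC subrK in pq.
  exists (fun l => if l == k then T2 true else if l == h then T2 false else set0),
    (cost (fun h' : bool => if h' then arc h else arc k) T2); split=> //.
  + apply: route_sub pq => -[]; first by exists k; rewrite eqxx.
    by exists h; rewrite (negbTE hk) eqxx.
  + have sU : nbhd (seg p (q - p)) d `<=` nbhd (\bigcup_h' T h') d.
      by apply: nbhdS; exact: (subset_trans pqh (bigcup_sup I)).
    move=> l; case: ifP => _; first exact: subset_trans (T2A true) sU.
    by case: ifP => _; [exact: subset_trans (T2A false) sU|exact: sub0set].
  + move=> i x [y [l /= li yl] [t ti ->]].
    have [ik|ik] := eqVneq i k.
      right; right; exists y; last by exists t => //; rewrite -ik.
      by move: yl; rewrite -ik (negbTE li); case: ifP.
    have [ih|ih] := eqVneq i h.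
      right; left; exists y; last by exists t => //; rewrite -ih.
      by move: yl; rewrite -ih (negbTE li); case: ifP.
    left; exists y; last by exists t.
    have seg_seen : seg p (q - p) `<=` seen T i.
      by move=> z /pqh Tz; exists h => //=; rewrite eq_sym.
    apply: (nbhdS seg_seen).
    by move: yl; case: ifP => _; [exact: (T2A true)|case: ifP => // _; exact: (T2A false)].
- have e2 : 0 < e / 2 by rewrite divr_gt0.
  have [T1 [W1 [r1 n1 c1 v1]]] := IH1 _ e2.
  have [T2 [W2 [r2 n2 c2 v2]]] := IH2 _ e2.
  exists (fun h => T1 h `|` T2 h), (W1 `|` W2); split.
  + apply: (@route_cat _ _ _ p q r); [apply: route_sub r1|apply: route_sub r2].
      by move=> h; exists h; exact: subsetUl.
    by move=> h; exists h; exact: subsetUr.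
  + by move=> h; rewrite subUset; split; [exact: n1|exact: n2].
  + by rewrite (splitr e); exact: covU.
  + move=> i x [y [h hi [yh|yh]] ty].
      have /v1[|] : reg (seen T1 i) (arc i) x by exists y => //; exists h.
        by left.
      by right; left.
    have /v2[|] : reg (seen T2 i) (arc i) x by exists y => //; exists h.
      by left.
    by right; right.
Qed.

(** Blocks of [ps] are treated one by one. The bound for the blocks already treated
has to survive the replacement of the path by a close one, hence the use of
[cov_nbhd] to fix in advance how close. *)
Lemma hide_all (h0 : L) (ps : seq L) (p u : V) d e :
  0 < d -> 0 < e -> safe M (seg p u) d ->
  exists T : L -> set V, [/\ route T p (p + u),
    (forall h, T h `<=` nbhd (seg p u) d) &
    cov (\bigcup_(i in [set i | i \in ps]) reg (seen T i) (arc i)) e].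
Proof.
elim: ps d e => [|k ps IH] d e d0 e0 sd.
  exists (fun h => if h == h0 then seg p u else set0); split.
  - by apply: (@route_seg _ _ _ h0); rewrite eqxx addrC addKr.
  - move=> h; case: ifP => _; [exact: sub_nbhd (ltW d0)|exact: sub0set].
  - by apply: covS (ltW e0) cov0 => x [i].
have d2 : 0 < d / 2 by rewrite divr_gt0.
have e2 : 0 < e / 2 by rewrite divr_gt0.
have [|T [pq Td Te]] := IH (d / 2) (e / 2) d2 e2.
  by move=> x /sd; apply: le_trans; rewrite lerD2l; lra.
have [c c0 Tc] := cov_nbhd Te.
pose d' := Num.min (d / 2) (c / 2).
have d'0 : 0 < d' by rewrite lt_min d2 divr_gt0.
have d'd : d' <= d / 2 by rewrite ge_min lexx.
have d'c : 2 * d' <= c.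
  have : d' <= c / 2 by rewrite ge_min lexx orbT.
  lra.
have sT h : safe M (T h) d'.
  apply: (safeS (Td h)); apply: safe_nbhd => x /sd; apply: le_trans; lra.
have [T' [W [pq' T'd Wc T's]]] := hide_one_more k pq sT d'0 e2.
exists T'; split=> //.
- move=> h; apply: subset_trans (T'd h) _.
  have : nbhd (nbhd (seg p u) (d / 2)) (d / 2) `<=` nbhd (seg p u) d.
    by rewrite {3}(splitr d); exact: nbhdD.
  apply: subset_trans; apply: subset_trans (nbhdW d'd) _; apply: nbhdS.
  by apply: bigcup_sub => h' _; exact: Td.
- apply: covS (covU Tc Wc); last by rewrite -splitr.
  move=> x [i /= ips /T's[]]; last by right.
  case: ifPn => // ik xi; left; apply: (nbhdW d'c); apply: (nbhdS _ (reg_nbhd xi)).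
  move=> y yi; exists i => //=.
  by move: ips; rewrite inE (negbTE ik).
Qed.

End refinement.

(** Angles are taken in [0, 2 * pi], cut into [n + 1] intervals of length at most
[gap]. A short end of each of them is left out, so that what remains are blocks at
positive distance; the left-out ends are exposed all the time, but any path close to
the segment sweeps little over them. *)
Lemma gap_crossing (M gap : R) (p u : V) d e :
  0 < M -> 0 < gap -> 0 < d -> 0 < e -> safe M (seg p u) d ->
  exists (L : finType) (start : L -> R) (T : L -> set V), [/\ route T p (p + u),
    (forall h, T h `<=` nbhd (seg p u) d) &
    cov (\bigcup_h reg (T h)
      (`[0, 2 * pi]%classic `\` `[start h, start h + gap[%classic)) e].
Proof.
move=> M0 gap0 d0 e0 sd.
have pi0 : 0 < pi :> R := pi_gt0 R.
have [n ng] : exists n : nat, 2 * pi / n.+1%:R <= gap.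
  exists (Num.truncn (2 * pi / gap)).
  rewrite ler_pdivrMr ?ltr0n// [leRHS]mulrC -ler_pdivrMr//.
  by rewrite ltW// truncnS_gt.
have n1 : 0 < n.+1%:R :> R by rewrite ltr0n.
pose b := 2 * pi / n.+1%:R : R.
have bgap : b <= gap := ng.
have b0 : 0 < b by rewrite divr_gt0// mulr_gt0.
have nb : n.+1%:R * b = 2 * pi by rewrite /b mulrC divfK// gt_eqF.
have b2pi : b <= 2 * pi.
  by rewrite -nb ler_peMl ?ler1n// ltW.
pose K := 16 * M * (3 * `|u|) * n.+1%:R.
have K0 : 0 <= K by rewrite !mulr_ge0// ltW.
have K1 : 0 < K + 1 by lra.
(* the second bound makes the left-out angles sweep at most [e / 4] in total *)
pose tau := Num.min (b / 2) (e / 4 / (K + 1)).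
have tau0 : 0 < tau.
  by rewrite lt_min divr_gt0//= divr_gt0// divr_gt0.
have tau_b : tau <= b / 2 by rewrite ge_min lexx.
have tau_e : K * tau <= e / 4.
  have : tau <= e / 4 / (K + 1) by rewrite ge_min lexx orbT.
  rewrite ler_pdivlMr// => h; apply: le_trans h.
  by rewrite mulrDr mulr1; lra.
pose start (i : 'I_n.+1) := i%:R * b : R.
pose sigma := 1 - cos tau.
have sigma0 : 0 < sigma.
  rewrite subr_gt0 -(cos0 R) ltr_cos// in_itv/=; apply/andP; split; lra.
have far i j : i != j -> forall s t, start i <= s <= start i + (b - tau) ->
    start j <= t <= start j + (b - tau) -> sigma <= 1 - cos (s - t).
  move=> ij s t; wlog ltij : i j s t ij / (i < j)%N.
    move=> H si tj; move: (ij); rewrite neq_ltn => /orP[/H|ji]; first exact.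
    by rewrite -cosN opprB; apply: (H j i) => //; rewrite eq_sym.
  rewrite /start => /andP[s1 s2] /andP[t1 t2].
  rewrite lerD2l lerN2 -cosN opprB; apply: cosBlt_away => //; first lra.
  have h1 : (i%:R + 1) * b <= j%:R * b by rewrite ler_pM2r// natr1 ler_nat.
  have h2 : (j%:R + 1) * b <= n.+1%:R * b by rewrite ler_pM2r// natr1 ler_nat.
  have h3 : 0 <= i%:R * b by rewrite mulr_ge0// ltW.
  by apply/andP; split; lra.
pose left_out (j : nat) : set R := `[j%:R * b + (b - tau), j%:R * b + (b - tau) + tau]%classic.
have pM x : seg p u x -> `|x.2| <= M.
  by move=> /sd; apply: le_trans; rewrite lerDl ltW.
have e4 : 0 < e / 4 / n.+1%:R by rewrite divr_gt0// divr_gt0.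
have e2 : 0 < e / 2 by rewrite divr_gt0.
have lo_cov : cov (\bigcup_(j in `I_n.+1) reg (seg p u) (left_out j)) (e / 2).
  apply: (covS (a := n.+1%:R * (16 * M * tau * (3 * `|u|) + e / 4 / n.+1%:R)) (@subset_refl _ _)).
    rewrite mulrDr [X in _ + X]mulrC divfK ?gt_eqF//.
    by move: tau_e; rewrite /K; lra.
  apply: cov_bigcup => j jn; apply: seg_cov => // s _; exact: norm_speed.
have [c c0 Lc] := cov_nbhd lo_cov.
pose d' := Num.min d (c / 2).
have d'0 : 0 < d' by rewrite lt_min d0 divr_gt0.
have d'd : d' <= d by rewrite ge_min lexx.
have d'c : 2 * d' <= c.
  have : d' <= c / 2 by rewrite ge_min lexx orbT.
  lra.
have bt0 : 0 < b - tau by lra.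
have sd' : safe M (seg p u) d' by move=> x /sd; apply: le_trans; rewrite lerD2l.
have [T [pq Td Tc]] := hide_all M0 sigma0 bt0 far ord0 (enum 'I_n.+1) d'0 e2 sd'.
exists 'I_n.+1, start, T; split => //.
  by move=> h; apply: subset_trans (Td h) (nbhdW d'd).
apply: covS (covU Tc Lc); last by rewrite -splitr.
move=> x [h _ [y Ty [t [/= t2pi th] ->]]].
have [|||j /= jn] := @split_itv _ 0 (2 * pi) n.+1 _ _ t => //.
- by rewrite mulr_ge0// ltW.
- by rewrite /= add0r.
rewrite in_itv/= add0r mulrAC -mulrA -/b => /andP[t1 t2].
have [tj|tj] := ltP t (j%:R * b + (b - tau)).
  left; exists (Ordinal jn); first by rewrite /= mem_enum.
  exists y; last by exists t => //; rewrite /= in_itv/= t1.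
  exists h => //=; apply/eqP => hj; apply: th.
  by rewrite /= in_itv/= hj /start/= t1/=; lra.
right; apply: (nbhdW d'c); apply: (nbhdS _ (reg_nbhd (A := seg p u) (S := left_out j) _)).
  by move=> z zj; exists j.
exists y; first exact: Td Ty.
by exists t => //; rewrite /left_out/= in_itv/= tj/=; lra.
Qed.

End many_blocks.

(** * Continuous paths of circles *)

Section paths.
Context {R : realType}.
Local Notation V := ((R * R) * R)%type.

(** Paths are defined on the whole line and constant outside [0, 1], so that two of
them can be concatenated by adding them, with no case distinction to spoil the
proof of continuity. *)
Definition joined (W : normedModType R) (P : set W) (x y : W) : Prop :=
  exists f : R -> W, [/\ continuous f, (forall t, t <= 0 -> f t = x),
    (forall t, 1 <= t -> f t = y) & forall t, P (f t)].

Lemma joined_cat (W : normedModType R) (P : set W) x y z :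
  joined P x y -> joined P y z -> joined P x z.
Proof.
move=> [f [cf f0 f1 fP]] [g [cg g0 g1 gP]].
exists (fun t => f (2 * t) + g (2 * t - 1) - y); split.
- move=> t; apply: cvgB; last exact: cvg_cst.
  have c2 : (2 * s @[s --> t] --> 2 * t) by apply: cvgM; [exact: cvg_cst|exact: cvg_id].
  apply: cvgD.
    by apply: (cvg_comp _ _ c2); exact: cf.
  have c3 : (2 * s - 1 @[s --> t] --> 2 * t - 1) by apply: cvgB; [exact: c2|exact: cvg_cst].
  by apply: (cvg_comp _ _ c3); exact: cg.
- move=> t t0; rewrite f0; last lra.
  by rewrite g0; [rewrite addrK|lra].
- move=> t t1; rewrite f1; last lra.
  by rewrite g1; [rewrite addrAC subrr add0r|lra].
- move=> t; have [t1|t1] := leP (2 * t) 1.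
    by rewrite (g0 (2 * t - 1)); [rewrite addrK|lra].
  by rewrite (f1 (2 * t)); [rewrite addrAC subrr add0r|lra].
Qed.

Lemma joined_seg (W : normedModType R) (P : set W) x y :
  (forall s, 0 <= s <= 1 -> P (x + s *: (y - x))) -> joined P x y.
Proof.
move=> Pxy; exists (fun t => x + Num.max 0 (Num.min t 1) *: (y - x)); split.
- move=> t; apply: cvgD; first exact: cvg_cst.
  apply: cvgZr_tmp.
  have c01 : {for t, continuous ((cst 0 : R -> R^o) \max ((id : R -> R^o) \min cst 1))}.
    apply: continuous_max; first exact: cvg_cst.
    by apply: continuous_min; [exact: cvg_id|exact: cvg_cst].
  exact: c01.
- move=> t t0; rewrite max_l ?scale0r ?addr0// ge_min t0//.
- move=> t t1; rewrite min_r// max_r// scale1r addrC subrK//.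
- move=> t; apply: Pxy.
  by rewrite le_max lexx ge_max ler01 ge_min lexx orbT.
Qed.

(** A circle has area zero; this is the case of a segment of circles that does not
move. *)
Lemma cov_circle (p : V) e : 0 < e -> cov (reg [set p] `[0, 2 * pi]) e.
Proof.
move=> e0; have pi0 : 0 < pi :> R := pi_gt0 R.
have M0 : 0 < `|p.2| + 1 by rewrite ltr_wpDl.
have pi2 : 0 < 2 * pi :> R by rewrite mulr_gt0.
apply: covS (@seg_cov _ (`|p.2| + 1) p 0 0 _ 0 e M0 pi2 e0 _ _).
- rewrite add0r; apply: regS => // _ ->; exact: seg_start.
- by rewrite mulr0 add0r.
- by move=> _ [s _ ->]; rewrite scaler0 addr0 lerDl.
- by move=> s _; rewrite /speed/= !mul0r !addr0 normr0.
Qed.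

Lemma route_end (L : Type) (T : L -> set V) (A : set V) p q :
  (forall h, T h `<=` A) -> route T p q -> A p -> A q.
Proof.
move=> TA; elim=> {p q}// [h p q pq _|p q r _ IH1 _ IH2 /IH1/IH2//].
apply: (TA h); apply: pq; exists 1; rewrite ?ler01 ?lexx//.
by rewrite scale1r addrC subrK.
Qed.

(** Along a piece with label [h] the second coordinate, the angle by which the arc is
turned, is [turn h]; it changes only while the circle stays at one of the finitely
many vertices, which form [F]. *)
Lemma route_joined (L : Type) (T : L -> set V) (turn : L -> R) (A : set V) p q e :
  (forall h, T h `<=` A) -> route T p q -> A p -> 0 < e ->
  exists F : set V, [/\ F `<=` A, cov (reg F `[0, 2 * pi]) e &
    forall a b, joined [set w : V * R | F w.1 \/ exists2 h, T h w.1 & w.2 = turn h]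
      (p, a) (q, b)].
Proof.
move=> TA pq; elim: pq e => {p q} [p|h p q pqh|p q r pq IH1 qr IH2] e Ap e0.
- exists [set p]; split; [by move=> _ ->|exact: cov_circle|].
  move=> a b; apply: joined_seg => s _; left.
  by rewrite /= subrr scaler0 addr0.
- have Aq : A q.
    by apply: (route_end TA _ Ap); exact: route_seg pqh.
  have e2 : 0 < e / 2 by rewrite divr_gt0.
  exists ([set p] `|` [set q]); split.
  + by move=> _ [->|->].
  + rewrite (splitr e); apply: covS (@regUl _ _ _ _) (lexx _) _.
    by apply: covU; exact: cov_circle.
  + move=> a b; apply: (@joined_cat _ _ _ (p, turn h)).
      by apply: joined_seg => s _; left; left; rewrite /= subrr scaler0 addr0.
    apply: (@joined_cat _ _ _ (q, turn h)).
      apply: joined_seg => s s01; right; exists h => /=.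
        by apply: pqh; exists s.
      by rewrite subrr scaler0 addr0.
    by apply: joined_seg => s _; left; right; rewrite /= subrr scaler0 addr0.
- have e2 : 0 < e / 2 by rewrite divr_gt0.
  have [F1 [FA1 c1 j1]] := IH1 _ Ap e2.
  have [F2 [FA2 c2 j2]] := IH2 _ (route_end TA pq Ap) e2.
  exists (F1 `|` F2); split.
  + by rewrite subUset.
  + rewrite (splitr e); apply: covS (@regUl _ _ _ _) (lexx _) _.
    exact: covU.
  + have sub (P Q : set (V * R)) x y : P `<=` Q -> joined P x y -> joined Q x y.
      by move=> PQ [f [cf f0 f1 fP]]; exists f; split => // t; exact: PQ.
    move=> a b; apply: (@joined_cat _ _ _ (q, 0)).
      by apply: sub (j1 a 0) => w [Fw|]; [left; left|right].
    by apply: sub (j2 0 b) => w [Fw|]; [left; right|right].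
Qed.

End paths.

(** * Similarities and isometries of the plane *)

Section similarities.
Context {R : realType}.
Local Notation V := ((R * R) * R)%type.

(** Stated for angles in [0, 2 * pi], so that it also serves to reduce an arbitrary
angle to that interval. *)
Lemma polar (x y : R) : x ^+ 2 + y ^+ 2 = 1 ->
  exists2 t, 0 <= t <= 2 * pi & x = cos t /\ y = sin t.
Proof.
move=> xy; have pi0 := pi_ge0 R.
have x1 : -1 <= x <= 1.
  by rewrite -ler_norml -(@expr_le1 _ 2)// real_normK ?num_real//; have := sqr_ge0 y; lra.
have [/andP[a0 api] ca] := acos_def x1.
have sa : sin (acos x) = `|y|.
  by rewrite sin_acos// (_ : 1 - _ = y ^+ 2) ?sqrtr_sqr//; lra.
have [y0|y0] := leP 0 y.
  exists (acos x); first by apply/andP; split; lra.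
  by rewrite ca sa ger0_norm.
exists (2 * pi - acos x); first by apply/andP; split; lra.
have -> : 2 * pi - acos x = - acos x + pi *+ 2 by rewrite -[pi *+ 2]mulr_natl addrC.
by rewrite cosD2pi sinD2pi cosN sinN ca sa ltr0_norm// opprK.
Qed.

Lemma pt_circle (c : R * R) (r : R) (x : R * R) : 0 < r -> circle c r x ->
  exists t, x = pt (c, r) t.
Proof.
move=> r0; rewrite /circle/= /edist => xr.
have h : (c.1 - x.1) ^+ 2 + (c.2 - x.2) ^+ 2 = r ^+ 2.
  by rewrite -xr sqr_sqrtr// addr_ge0// sqr_ge0.
have rn0 : r != 0 by rewrite gt_eqF.
have [|t _ [ht1 ht2]] := @polar ((x.1 - c.1) / r) ((x.2 - c.2) / r).
  rewrite !expr_div_n -mulrDl (_ : _ + _ = r ^+ 2).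
    by rewrite divff// expf_neq0.
  by rewrite -h; ring.
exists t; rewrite /pt/= -ht1 -ht2 !(mulrC r) !divfK// ![_ + (_ - _)]addrC !subrK.
by case: (x).
Qed.

Lemma pt_angle (p : V) (s t : R) : `|pt p s - pt p t| <= `|p.2| * `|s - t|.
Proof.
have [_ _] := norm_pair (pt p s - pt p t); apply; rewrite /=.
  by rewrite (_ : _ - _ = p.2 * (cos s - cos t)) ?normrM ?ler_wpM2l ?cos_lip//; ring.
by rewrite (_ : _ - _ = p.2 * (sin s - sin t)) ?normrM ?ler_wpM2l ?sin_lip//; ring.
Qed.

Lemma missing_arc (c : R * R) (r : R) (E : set (R * R)) : 0 < r ->
  E `<=` circle c r -> closed E -> E <> circle c r ->
  exists phi gap : R, 0 < gap /\
    forall t, phi <= t <= phi + gap -> ~ E (pt (c, r) t).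
Proof.
move=> r0 Ec clE Enc.
have [x cx nEx] : exists2 x, circle c r x & ~ E x.
  apply: contrapT => H; apply: Enc; apply/seteqP; split => // x cx.
  by apply: contrapT => nEx; apply: H; exists x.
have [phi xphi] := pt_circle r0 cx.
have /nbhs_ballP[d /= d0 dE] : nbhs x (~` E).
  by apply: open_nbhs_nbhs; split => //; exact: closed_openC.
exists phi, (d / (2 * r)); split; first by rewrite divr_gt0// mulr_gt0.
move=> t /andP[t1 t2]; apply: dE.
rewrite -ball_normE/= xphi (le_lt_trans (pt_angle _ _ _))//= gtr0_norm//.
rewrite distrC ger0_norm ?subr_ge0//.
apply: (@le_lt_trans _ _ (r * (d / (2 * r)))).
  by rewrite ler_pM2l//; lra.
have -> : r * (d / (2 * r)) = d / 2 by field; rewrite gt_eqF.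
by lra.
Qed.

(** The similarity that carries the circle [(c, r)] to the circle [w.1] and turns it
by the angle [w.2]. *)
Definition carry (c : R * R) (r : R) (w : V * R) (z : R * R) : R * R :=
  (w.1.1.1 + w.1.2 / r * (cos w.2 * (z.1 - c.1) - sin w.2 * (z.2 - c.2)),
   w.1.1.2 + w.1.2 / r * (sin w.2 * (z.1 - c.1) + cos w.2 * (z.2 - c.2))).

Lemma carry_pt c r w t : r != 0 -> carry c r w (pt (c, r) t) = pt w.1 (t + w.2).
Proof.
move=> r0; rewrite /carry /pt/= cosD sinD; congr (_, _); by field.
Qed.

Lemma carry_id c r : r != 0 -> carry c r ((c, r), 0) = id.
Proof.
move=> r0; apply/funext => z; rewrite /carry/= cos0 sin0 divff//.
rewrite !mul0r !mul1r subr0 add0r [X in (X, _)]addrC [X in (_, X)]addrC !subrK.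
by case: z.
Qed.

Lemma carry_similarity c r w : 0 < r -> 0 < w.1.2 -> similarity (w.1.2 / r) (carry c r w).
Proof.
move=> r0 w0; split; first by rewrite divr_gt0.
move=> x y; have k0 : 0 <= w.1.2 / r by rewrite divr_ge0// ltW.
rewrite /edist /carry/=; set k := w.1.2 / r in k0 *.
transitivity (Num.sqrt (k ^+ 2 * ((x.1 - y.1) ^+ 2 + (x.2 - y.2) ^+ 2))); last first.
  by rewrite sqrtrM ?sqr_ge0// sqrtr_sqr ger0_norm.
congr Num.sqrt; rewrite /=.
transitivity (k ^+ 2 * ((x.1 - y.1) ^+ 2 + (x.2 - y.2) ^+ 2) * (cos w.2 ^+ 2 + sin w.2 ^+ 2)).
  by ring.
by rewrite cos2Dsin2 mulr1.
Qed.

Lemma carry_orientation c r w : 0 < r -> 0 < w.1.2 -> orientation_preserving (carry c r w).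
Proof.
move=> r0 w0; rewrite /orientation_preserving /carry/=.
have k0 : 0 < w.1.2 / r by rewrite divr_gt0.
set k := w.1.2 / r in k0 *.
rewrite (_ : _ - _ = k ^+ 2 * (cos w.2 ^+ 2 + sin w.2 ^+ 2)); last by ring.
by rewrite cos2Dsin2 mulr1 exprn_gt0.
Qed.

Lemma carry_continuous c r (f : R -> V * R) : continuous f ->
  continuous (fun x : R * (R * R) => carry c r (f x.1) x.2).
Proof.
move=> cf x.
have c1 : (fst @ x --> x.1) by exact: cvg_fst.
have c2 : (snd @ x --> x.2) by exact: cvg_snd.
have cfx : (f y.1 @[y --> x] --> f x.1).
  exact: (cvg_comp fst f c1 (cf x.1)).
have pf (U W : topologicalType) (g : R * (R * R) -> U * W) :
  g y @[y --> x] --> g x -> (g y).1 @[y --> x] --> (g x).1.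
  by move=> gx; apply: (cvg_comp _ fst gx); exact: cvg_fst.
have ps (U W : topologicalType) (g : R * (R * R) -> U * W) :
  g y @[y --> x] --> g x -> (g y).2 @[y --> x] --> (g x).2.
  by move=> gx; apply: (cvg_comp _ snd gx); exact: cvg_snd.
have cw := pf _ _ _ cfx; have ca := ps _ _ _ cfx.
have cc := pf _ _ _ cw; have cr := ps _ _ _ cw.
have cx := pf _ _ _ cc; have cy := ps _ _ _ cc.
have cz1 := pf _ _ _ c2; have cz2 := ps _ _ _ c2.
have ccos : cos (f y.1).2 @[y --> x] --> cos (f x.1).2.
  by apply: (cvg_comp _ cos ca); exact: continuous_cos.
have csin : sin (f y.1).2 @[y --> x] --> sin (f x.1).2.
  by apply: (cvg_comp _ sin ca); exact: continuous_sin.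
have c1z : y.2.1 - c.1 @[y --> x] --> x.2.1 - c.1.
  by apply: cvgB; [exact: cz1|exact: cvg_cst].
have c2z : y.2.2 - c.2 @[y --> x] --> x.2.2 - c.2.
  by apply: cvgB; [exact: cz2|exact: cvg_cst].
have crr : (f y.1).1.2 / r @[y --> x] --> (f x.1).1.2 / r.
  by apply: cvgM; [exact: cr|exact: cvg_cst].
pose g1 (y : R * (R * R)) : R := (f y.1).1.1.1 + (f y.1).1.2 / r *
  (cos (f y.1).2 * (y.2.1 - c.1) - sin (f y.1).2 * (y.2.2 - c.2)).
pose g2 (y : R * (R * R)) : R := (f y.1).1.1.2 + (f y.1).1.2 / r *
  (sin (f y.1).2 * (y.2.1 - c.1) + cos (f y.1).2 * (y.2.2 - c.2)).
suff [cg1 cg2] : (g1 y @[y --> x] --> g1 x) /\ (g2 y @[y --> x] --> g2 x).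
  exact: (cvg_pair cg1 cg2).
split; apply: cvgD.
- exact: cx.
- apply: cvgM; first exact: crr.
  by apply: cvgB; apply: cvgM; [exact: ccos|exact: c1z|exact: csin|exact: c2z].
- exact: cy.
- apply: cvgM; first exact: crr.
  by apply: cvgD; apply: cvgM; [exact: csin|exact: c1z|exact: ccos|exact: c2z].
Qed.

(** The images of the two basis vectors are orthonormal, and positivity of the
determinant fixes the second one once the first is known; distances to three points
then determine the image of each point. *)
Lemma isom_carry c r (g : R * R -> R * R) : 0 < r -> Isom_plus g ->
  exists a, g = carry c r ((g c, r), a).
Proof.
move=> r0 [gd]; rewrite /orientation_preserving.
have sq x y : ((g x).1 - (g y).1) ^+ 2 + ((g x).2 - (g y).2) ^+ 2 =
    (x.1 - y.1) ^+ 2 + (x.2 - y.2) ^+ 2.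
  have nn (a b : R) : 0 <= a ^+ 2 + b ^+ 2 by rewrite addr_ge0// sqr_ge0.
  by have := congr1 (fun x => x ^+ 2) (gd x y); rewrite /edist !sqr_sqrtr.
have := sq (1, 0) (0, 0); have := sq (0, 1) (0, 0); have := sq (1, 0) (0, 1).
rewrite /= !(subr0, sub0r, sqrrN, expr0n, expr1n, addr0, add0r)/=.
set o := g (0, 0); set gu := g (1, 0); set gv := g (0, 1).
set u1 := gu.1 - o.1; set u2 := gu.2 - o.2; set v1 := gv.1 - o.1; set v2 := gv.2 - o.2.
move=> uv vv uu; rewrite -/u1 -/u2 -/v1 -/v2 => det0.
have uv0 : u1 * v1 + u2 * v2 = 0.
  have : (gu.1 - gv.1) = u1 - v1 by rewrite /u1 /v1; ring.
  have : (gu.2 - gv.2) = u2 - v2 by rewrite /u2 /v2; ring.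
  by move=> e2 e1; move: uv; rewrite e1 e2; nra.
have det1 : u1 * v2 - u2 * v1 = 1.
  have : (u1 * v2 - u2 * v1) ^+ 2 = 1.
    transitivity ((u1 ^+ 2 + u2 ^+ 2) * (v1 ^+ 2 + v2 ^+ 2) - (u1 * v1 + u2 * v2) ^+ 2); first by ring.
    by rewrite uu vv uv0; ring.
  by move/eqP; rewrite sqrf_eq1 => /orP[/eqP//|/eqP h]; move: det0; rewrite h; lra.
have v1E : v1 = - u2.
  transitivity (u1 * (u1 * v1 + u2 * v2) - u2 * (u1 * v2 - u2 * v1) + v1 * (1 - (u1 ^+ 2 + u2 ^+ 2))); first by ring.
  by rewrite uv0 det1 uu; ring.
have v2E : v2 = u1.
  transitivity (u2 * (u1 * v1 + u2 * v2) + u1 * (u1 * v2 - u2 * v1) + v2 * (1 - (u1 ^+ 2 + u2 ^+ 2))); first by ring.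
  by rewrite uv0 det1 uu; ring.
have [a _ [ua1 ua2]] := polar uu.
have gE z : (g z).1 = o.1 + (z.1 * u1 - z.2 * u2) /\ (g z).2 = o.2 + (z.1 * u2 + z.2 * u1).
  have := sq z (0, 0); have := sq z (1, 0); have := sq z (0, 1).
  rewrite /= !subr0 -/o -/gu -/gv.
  set w1 := (g z).1 - o.1; set w2 := (g z).2 - o.2.
  have -> : (g z).1 - gv.1 = w1 - v1 by rewrite /w1 /v1; ring.
  have -> : (g z).2 - gv.2 = w2 - v2 by rewrite /w2 /v2; ring.
  have -> : (g z).1 - gu.1 = w1 - u1 by rewrite /w1 /u1; ring.
  have -> : (g z).2 - gu.2 = w2 - u2 by rewrite /w2 /u2; ring.
  rewrite v1E v2E => hv hu hw.
  have wu : w1 * u1 + w2 * u2 = z.1 by lra.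
  have wv : - w1 * u2 + w2 * u1 = z.2 by lra.
  have -> : (g z).1 = o.1 + w1 by rewrite /w1 addrC subrK.
  have -> : (g z).2 = o.2 + w2 by rewrite /w2 addrC subrK.
  rewrite -wu -wv; split; congr (_ + _).
    by transitivity (w1 * (u1 ^+ 2 + u2 ^+ 2)); [rewrite uu mulr1|ring].
  by transitivity (w2 * (u1 ^+ 2 + u2 ^+ 2)); [rewrite uu mulr1|ring].
exists a; apply/funext => z; rewrite /carry/= divff ?gt_eqF// mul1r -ua1 -ua2.
have [g1 g2] := gE z; have [h1 h2] := gE c.
rewrite [LHS]surjective_pairing g1 g2 h1 h2; congr (_, _); ring.
Qed.

End similarities.

(** * The motion of the arc *)

Unset Implicit Arguments.

Theorem corollary1p10 (R : realType) (c : R * R) (r : R) (E : set (R * R))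
    (r_gt0 : 0 < r) (E_arc : circular_arc c r E) (E_not_full : E <> circle c r)
    (g : R * R -> R * R) (g_isom : Isom_plus g)
    (eps eta : R) (eps_gt0 : 0 < eps) (eta_gt0 : 0 < eta) :
  exists gamma : R -> R * R -> R * R,
    [/\ (forall t, t \in `[0, 1] -> Sim_plus (gamma t)),
        continuous_motion gamma,
        gamma 0 = id /\ gamma 1 = g,
        (area (swept gamma E) < eps%:E)%E &
        forall t, t \in `[0, 1] ->
          exists2 rho, similarity rho (gamma t) & 1 - eta < rho < 1 + eta].
Proof.
have [Ec clE _] := E_arc.
have [phi [gap [gap0 gapE]]] := missing_arc r_gt0 Ec clE E_not_full.
have [a gE] := isom_carry c r_gt0 g_isom.
have rn0 : r != 0 by rewrite gt_eqF.
pose p : (R * R) * R := (c, r); pose q : (R * R) * R := (g c, r).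
(* the first bound keeps the radius positive, the second one the ratio close to 1 *)
pose d := Num.min (r / 2) (eta / 2 * r).
have d0 : 0 < d by rewrite lt_min divr_gt0//= mulr_gt0// divr_gt0.
have dr : d <= r / 2 by rewrite ge_min lexx.
have deta : d <= eta / 2 * r by rewrite ge_min lexx orbT.
have M0 : 0 < r + d by rewrite addr_gt0.
have e4 : 0 < eps / 4 by rewrite divr_gt0.
have segr x : seg p (q - p) x -> x.2 = r.
  by move=> [s _ ->]; rewrite /= subrr scaler0 addr0.
have sd : safe (r + d) (seg p (q - p)) d.
  by move=> x /segr ->; rewrite gtr0_norm.
have [L [start [T [pq Td Tc]]]] := gap_crossing M0 gap0 d0 e4 sd.
rewrite [p + _]addrC subrK in pq.
have pA : nbhd (seg p (q - p)) d p by apply: sub_nbhd (ltW d0) _ _; exact: seg_start.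
(* turning by [start h - phi] places the gap, which begins at [phi], over block [h] *)
have [F [FA Fc]] := route_joined (fun h => start h - phi) Td pq pA e4.
move=> /(_ 0 a) [f [cf f0 f1 fP]].
have near_r t : `|(f t).1.2 - r| <= d.
  have [y /segr yr fy] : nbhd (seg p (q - p)) d (f t).1.
    by case: (fP t) => [/FA|[h /Td]].
  have [_ _] := normV_coord ((f t).1 - y); rewrite /= yr => h.
  exact: le_trans fy.
have ratio t : 1 - eta < (f t).1.2 / r < 1 + eta.
  have := near_r t; rewrite ler_norml => /andP[h1 h2].
  rewrite ltr_pdivlMr// ltr_pdivrMr// !mulrDl mul1r mulNr.
  have er : 0 < eta * r by rewrite mulr_gt0.
  by apply/andP; split; lra.
have pos t : 0 < (f t).1.2.
  by have := near_r t; rewrite ler_norml => /andP[h1 h2]; lra.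
have sim t : similarity ((f t).1.2 / r) (carry c r (f t)) by exact: carry_similarity.
exists (fun t => carry c r (f t)); split.
- by move=> t _; split; [exists ((f t).1.2 / r)|exact: carry_orientation].
- apply: continuous_subspaceT.
  exact: (continuous_curry_fun (carry_continuous (c := c) (r := r) cf)).
- by rewrite f0// f1// carry_id// -gE.
- apply: (@le_lt_trans _ _ (eps / 4 + eps / 4)%:E); last by rewrite lte_fin; lra.
  apply: cov_area; apply: covS (lexx _) (covU Fc Tc).
  move=> _ [t _ [e Ee <-]].
  have [th eth] := pt_circle r_gt0 (Ec _ Ee).
  rewrite eth carry_pt//.
  have [om om2pi [c_om s_om]] := polar (cos2Dsin2 (th + (f t).2)).
  have -> : pt (f t).1 (th + (f t).2) = pt (f t).1 om by rewrite /pt c_om s_om.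
  have [Ft|[h Th turn]] := fP t; first by left; exists (f t).1 => //; exists om.
  right; exists h => //; exists (f t).1 => //; exists om => //; split => //.
  rewrite /= in_itv/= => /andP[om1 om2].
  apply: (gapE (om - (f t).2)).
    by rewrite turn; apply/andP; split; lra.
  suff -> : pt (c, r) (om - (f t).2) = e by [].
  rewrite eth /pt/= cosB sinB -c_om -s_om -cosB -sinB.
  by rewrite addrK.
- by move=> t _; exists ((f t).1.2 / r).
Qed.
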